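(* Let $f_1,f_2\in{\cal N}_1$. Then $f_1f_2\in{\cal N}_1$ if and only if the divisor $((a_n),(b_n))$ of $f_1f_2$ satisfies $\inf_{n,k}|a_n-b_k|>0$ and there is $R_0<\infty$ such that every disc $B(w,R_0)$, $w\in\mathbb{C}$, contains some $a_n$ and some $b_k$. The same statement holds with ${\cal N}_1$ replaced by ${\cal AE}$ throughout.
   Context: $\rho_S$ is the spherical metric. A meromorphic $f$ on $\mathbb{C}$ is normal if every sequence of translates $f(z+h_n)$ has a subsequence Cauchy in $\rho_S$ uniformly on compacta; $f\in{\cal N}_1$ if moreover no limit of translates is a constant (including $\infty$). A nonconstant meromorphic $f$ is in ${\cal AE}$ if for every $\varepsilon>0$ there is $L$ such that every disc of radius $L$ contains $\tau$ with $\rho_S(f(z+\tau),f(z))<\varepsilon$ for all $z\in\mathbb{C}$. The divisor of $f_1f_2$ lists its zeros $a_n$ and poles $b_n$ with multiplicities (after cancellation). *)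

(* Defs.v *)
From Stdlib Require Import Reals.
Open Scope R_scope.

Definition Cplx : Type := (R * R)%type.
Definition C0 : Cplx := (0, 0).
Definition Cadd (z w : Cplx) : Cplx := (fst z + fst w, snd z + snd w).
Definition Csub (z w : Cplx) : Cplx := (fst z - fst w, snd z - snd w).
Definition Cmul (z w : Cplx) : Cplx :=
  (fst z * fst w - snd z * snd w, fst z * snd w + snd z * fst w).
Definition Cinv (z : Cplx) : Cplx :=
  (fst z / (fst z ^ 2 + snd z ^ 2), - snd z / (fst z ^ 2 + snd z ^ 2)).
Definition Cdiv (z w : Cplx) : Cplx := Cmul z (Cinv w).
Definition Cnorm (z : Cplx) : R := sqrt (fst z ^ 2 + snd z ^ 2).

(* Riemann sphere: Some z = finite point z, None = infinity. *)
Definition Csph : Type := option Cplx.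

Definition rho (p q : Csph) : R :=
  match p, q with
  | Some z, Some w => 2 * Cnorm (Csub z w) /
                      sqrt ((1 + Cnorm z ^ 2) * (1 + Cnorm w ^ 2))
  | Some z, None | None, Some z => 2 / sqrt (1 + Cnorm z ^ 2)
  | None, None => 0
  end.

Definition sph_inv (p : Csph) : Csph :=
  match p with
  | None => Some C0
  | Some z => if Req_EM_T (fst z) 0 then
                if Req_EM_T (snd z) 0 then None else Some (Cinv z)
              else Some (Cinv z)
  end.

Definition holo_on_disc (F : Cplx -> Cplx) (z0 : Cplx) (r : R) : Prop :=
  forall z, Cnorm (Csub z z0) < r ->
    exists l : Cplx, forall eps, 0 < eps -> exists delta, 0 < delta /\
      forall h : Cplx, h <> C0 -> Cnorm h < delta ->
        Cnorm (Csub (Cdiv (Csub (F (Cadd z h)) (F z)) h) l) < eps.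

Definition meromorphic (f : Cplx -> Csph) : Prop :=
  forall z0, exists r, 0 < r /\ exists F : Cplx -> Cplx, holo_on_disc F z0 r /\
    ((forall z, Cnorm (Csub z z0) < r -> f z = Some (F z)) \/
     (forall z, Cnorm (Csub z z0) < r -> sph_inv (f z) = Some (F z))).

Definition nonconstant (f : Cplx -> Csph) : Prop := exists z w, f z <> f w.

Definition normal (f : Cplx -> Csph) : Prop :=
  meromorphic f /\
  forall h : nat -> Cplx, exists phi : nat -> nat,
    (forall n, (phi n < phi (S n))%nat) /\
    forall r eps, 0 < eps -> exists N, forall m n, (N <= m)%nat -> (N <= n)%nat ->
      forall z, Cnorm z <= r ->
        rho (f (Cadd z (h (phi m)))) (f (Cadd z (h (phi n)))) < eps.

Definition has_constant_translate_limit (f : Cplx -> Csph) : Prop :=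
  exists (h : nat -> Cplx) (c : Csph),
    forall r eps, 0 < eps -> exists N, forall n, (N <= n)%nat ->
      forall z, Cnorm z <= r -> rho (f (Cadd z (h n))) c < eps.

Definition in_N1 (f : Cplx -> Csph) : Prop :=
  normal f /\ ~ has_constant_translate_limit f.

Definition in_AE (f : Cplx -> Csph) : Prop :=
  meromorphic f /\ nonconstant f /\
  forall eps, 0 < eps -> exists L, forall w : Cplx,
    exists tau : Cplx, Cnorm (Csub tau w) < L /\
      forall z, rho (f (Cadd z tau)) (f z) < eps.

(* g is the meromorphic product f1 f2: it agrees with the pointwise product
   wherever both factors are finite (this determines g uniquely when f1, f2
   are not identically infinity). *)
Definition is_product (f1 f2 g : Cplx -> Csph) : Prop :=
  meromorphic g /\
  forall z z1 z2, f1 z = Some z1 -> f2 z = Some z2 -> g z = Some (Cmul z1 z2).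

Definition divisor_cond (g : Cplx -> Csph) : Prop :=
  (exists d, 0 < d /\ forall a b, g a = Some C0 -> g b = None ->
      d <= Cnorm (Csub a b)) /\
  (exists R0, forall w : Cplx,
      (exists a, Cnorm (Csub a w) < R0 /\ g a = Some C0) /\
      (exists b, Cnorm (Csub b w) < R0 /\ g b = None)).

(* Main.v *)
Require Import Defs.
From Stdlib Require Import Reals.
From Stdlib Require Import Lra Lia Psatz List Classical ClassicalEpsilon.
From Coquelicot Require Import Coquelicot.
Open Scope R_scope.

(** The whole argument rests on the maximum principle, obtained from Goursat's
    theorem in polar coordinates.  It gives a Blaschke type estimate, hence
    zeros of a limit of translates of [f] in N_1 are isolated: an accumulation
    point would spread, with a radius independent of the point, and make the
    limit constant.  So around each point there are small circles on which
    translates of [f1] and [f2] stay uniformly away from 0 and infinity;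
    translates of [g] converge there, and since zeros and poles of [g] are
    separated the maximum principle applied to [g] or [1/g] carries convergence
    inside.  The relative density of zeros and poles forbids constant limits.
    Conversely, if [f] in N_1 has no poles in discs [B(w_n, n)], then either [f]
    is bounded on [B(w_n, n/2)] and a constant limit appears by Schwarz's lemma,
    or some translates tend to infinity at 0 without poles nearby, which
    contradicts the maximum principle on a circle around 0.

    Almost periodic functions are in N_1 by Bochner's criterion.  If small
    common almost periods of [f1], [f2] were not almost periods of [g],
    interleaving the bad points with their translates would give a sequence
    along which [f1], [f2] converge and [g] does not. *)

(** * Goursat's theorem for real rectangles *)

(** Multiplication is not continuous at the pair (0, infinity), so convergence of the translates of
    [f1] and [f2] says nothing about [g] where a zero of one factor meets a pole of the other; this
    is why [g] is first compared on circles, where both factors are finite and [is_product] gives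
    its values. Limits of translates are never formed. Normality is a Cauchy condition, so a zero of
    the limit becomes a point at which the translates tend to 0, and a statement about the limit
    becomes one about all translates of large index. Such asymptotic zeros are divided out one at a
    time. The quotient is then only known to be continuous at the point divided out, which forces a
    maximum principle that tolerates finitely many points of mere continuity, and hence a mean value
    property in which the centre is reached by continuity alone. The metric [rho] is invariant under
    z -> 1/z, so zeros are studied and the results for poles follow by inversion. *)

(** The counterclockwise boundary integral of P ds + Q dt over the rectangle with corner (x, y) and
    sides w, v. Opposite sides share one integral, so that constants cancel inside the integrand. *)
Definition circulation (P Q : R -> R -> R) (x y w v : R) : R :=
  RInt (fun s => P s y - P s (y + v)) x (x + w) +
  RInt (fun t => Q (x + w) t - Q x t) y (y + v).

(** The shared [k] expresses that the t-derivative of P equals the s-derivative of Q. Total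
    differentiability at the point is asked, with no continuity of derivatives; bisection replaces
    Green's formula for this reason. *)
Definition closed_form_at (P Q : R -> R -> R) (x y : R) : Prop :=
  exists px k qy, differentiable_pt_lim P x y px k /\
                  differentiable_pt_lim Q x y k qy.

Lemma differentiable_pt_lim_continuous_fst P x y px py :
  differentiable_pt_lim P x y px py -> continuous (fun s => P s y) x.
Proof.
  intro H. apply continuity_pt_filterlim.
  apply derivable_continuous_pt. exists (px * 1 + py * 0).
  apply (derivable_pt_lim_comp_2d P (fun t => t) (fun _ => y)).
  - exact H.
  - apply derivable_pt_lim_id.
  - apply derivable_pt_lim_const.
Qed.

Lemma differentiable_pt_lim_continuous_snd P x y px py :
  differentiable_pt_lim P x y px py -> continuous (fun t => P x t) y.
Proof.
  intro H. apply continuity_pt_filterlim.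
  apply derivable_continuous_pt. exists (px * 0 + py * 1).
  apply (derivable_pt_lim_comp_2d P (fun _ => x) (fun t => t)).
  - exact H.
  - apply derivable_pt_lim_const.
  - apply derivable_pt_lim_id.
Qed.

Lemma ex_RInt_cont (f : R -> R) a b :
  a <= b -> (forall z, a <= z <= b -> continuous f z) -> ex_RInt f a b.
Proof.
  intros Hab H. apply (ex_RInt_continuous (V := R_CompleteNormedModule)).
  intros z. rewrite Rmin_left, Rmax_right by lra. apply H.
Qed.

(** Every inner edge is traversed twice in opposite directions, so only the outer boundary
    remains. *)
Lemma circulation_split P Q x y a b :
  0 < a -> 0 < b ->
  (forall s t, x <= s <= x + 2 * a -> y <= t <= y + 2 * b ->
     closed_form_at P Q s t) ->
  circulation P Q x y (2 * a) (2 * b) =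
  circulation P Q x y a b + circulation P Q (x + a) y a b +
  circulation P Q x (y + b) a b + circulation P Q (x + a) (y + b) a b.
Proof.
  intros Ha Hb HD. unfold circulation.
  assert (CP : forall t u v, y <= t <= y + 2 * b -> x <= u -> u <= v -> v <= x + 2 * a ->
            ex_RInt (fun s => P s t) u v).
  { intros t u v Ht Hu Huv Hv. apply ex_RInt_cont; [lra|]. intros z Hz.
    destruct (HD z t) as (px & k & qy & H1 & _); [lra|lra|].
    eapply differentiable_pt_lim_continuous_fst; eauto. }
  assert (CQ : forall s u v, x <= s <= x + 2 * a -> y <= u -> u <= v -> v <= y + 2 * b ->
            ex_RInt (fun t => Q s t) u v).
  { intros s u v Ht Hu Huv Hv. apply ex_RInt_cont; [lra|]. intros z Hz.
    destruct (HD s z) as (px & k & qy & _ & H1); [lra|lra|].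
    eapply differentiable_pt_lim_continuous_snd; eauto. }
  assert (MP : forall t t' u v, y <= t <= y + 2 * b -> y <= t' <= y + 2 * b ->
            x <= u -> u <= v -> v <= x + 2 * a ->
            RInt (fun s => P s t - P s t') u v =
            RInt (fun s => P s t) u v - RInt (fun s => P s t') u v).
  { intros. apply (RInt_minus (V := R_CompleteNormedModule)); apply CP; lra. }
  assert (MQ : forall s s' u v, x <= s <= x + 2 * a -> x <= s' <= x + 2 * a ->
            y <= u -> u <= v -> v <= y + 2 * b ->
            RInt (fun t => Q s t - Q s' t) u v =
            RInt (fun t => Q s t) u v - RInt (fun t => Q s' t) u v).
  { intros. apply (RInt_minus (V := R_CompleteNormedModule)); apply CQ; lra. }
  replace (x + a + a) with (x + 2 * a) by ring.
  replace (y + b + b) with (y + 2 * b) by ring.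
  rewrite !MP by lra. rewrite !MQ by lra.
  assert (SP : forall t, y <= t <= y + 2 * b ->
     RInt (fun s => P s t) x (x + 2 * a) =
     RInt (fun s => P s t) x (x + a) + RInt (fun s => P s t) (x + a) (x + 2 * a)).
  { intros. symmetry. apply (RInt_Chasles (V := R_CompleteNormedModule)); apply CP; lra. }
  assert (SQ : forall s, x <= s <= x + 2 * a ->
     RInt (fun t => Q s t) y (y + 2 * b) =
     RInt (fun t => Q s t) y (y + b) + RInt (fun t => Q s t) (y + b) (y + 2 * b)).
  { intros. symmetry. apply (RInt_Chasles (V := R_CompleteNormedModule)); apply CQ; lra. }
  rewrite !SP by lra. rewrite !SQ by lra. ring.
Qed.

(** The affine part of a closed form has circulation zero: the horizontal sides contribute - k w v
    and the vertical ones + k w v. What is left is the remainder, at most 2 e r in each of the two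
    integrands. *)
Lemma circulation_small P Q x y w v X Y e r px k qy :
  0 < w -> 0 < v -> x <= X <= x + w -> y <= Y <= y + v -> w <= r -> v <= r ->
  (forall s t, x <= s <= x + w -> y <= t <= y + v -> closed_form_at P Q s t) ->
  (forall s t, Rabs (s - X) <= r -> Rabs (t - Y) <= r ->
     Rabs (P s t - P X Y - (px * (s - X) + k * (t - Y))) <= e * r /\
     Rabs (Q s t - Q X Y - (k * (s - X) + qy * (t - Y))) <= e * r) ->
  Rabs (circulation P Q x y w v) <= 2 * (w + v) * (e * r).
Proof.
  intros Hw Hv HX HY Hwr Hvr HD HE. unfold circulation.
  assert (I1 : ex_RInt (fun s => P s y - P s (y + v)) x (x + w)).
  { apply ex_RInt_cont; [lra|]. intros z Hz.
    destruct (HD z y) as (p1 & k1 & q1 & H1 & _); [lra|lra|].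
    destruct (HD z (y + v)) as (p2 & k2 & q2 & H2 & _); [lra|lra|].
    apply (continuous_minus (V := R_NormedModule));
      eapply differentiable_pt_lim_continuous_fst; eauto. }
  assert (I2 : ex_RInt (fun t => Q (x + w) t - Q x t) y (y + v)).
  { apply ex_RInt_cont; [lra|]. intros z Hz.
    destruct (HD x z) as (p1 & k1 & q1 & _ & H1); [lra|lra|].
    destruct (HD (x + w) z) as (p2 & k2 & q2 & _ & H2); [lra|lra|].
    apply (continuous_minus (V := R_NormedModule));
      eapply differentiable_pt_lim_continuous_snd; eauto. }
  assert (J : forall (f : R -> R) (u d c M : R), 0 < d -> ex_RInt f u (u + d) ->
     (forall z, u <= z <= u + d -> Rabs (f z - c) <= M) ->
     Rabs (RInt f u (u + d) - d * c) <= d * M).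
  { intros f u d c M Hd If Hf.
    replace (d * c) with (RInt (fun _ => c) u (u + d)).
    2:{ rewrite (RInt_const (V := R_CompleteNormedModule)). unfold scal; simpl.
        unfold mult; simpl. ring. }
    rewrite <- (RInt_minus (V := R_CompleteNormedModule) f (fun _ => c));
      [|assumption|apply ex_RInt_const].
    replace (d * M) with ((u + d - u) * M) by ring.
    apply abs_RInt_le_const; [lra| |exact Hf].
    apply (ex_RInt_minus (V := R_CompleteNormedModule) f (fun _ => c));
      [assumption|apply ex_RInt_const]. }
  assert (K1 := J _ x w (- k * v) (2 * (e * r)) Hw I1).
  assert (K2 := J _ y v (k * w) (2 * (e * r)) Hv I2).
  assert (L1 : Rabs (RInt (fun s => P s y - P s (y + v)) x (x + w) - w * (- k * v))
      <= w * (2 * (e * r))).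
  { apply K1. intros z Hz.
    destruct (HE z y) as [A1 _]; [apply Rabs_le; lra|apply Rabs_le; lra|].
    destruct (HE z (y + v)) as [A2 _]; [apply Rabs_le; lra|apply Rabs_le; lra|].
    apply Rabs_le. apply Rabs_le_between in A1. apply Rabs_le_between in A2.
    split; nra. }
  assert (L2 : Rabs (RInt (fun t => Q (x + w) t - Q x t) y (y + v) - v * (k * w))
      <= v * (2 * (e * r))).
  { apply K2. intros z Hz.
    destruct (HE x z) as [_ A1]; [apply Rabs_le; lra|apply Rabs_le; lra|].
    destruct (HE (x + w) z) as [_ A2]; [apply Rabs_le; lra|apply Rabs_le; lra|].
    apply Rabs_le. apply Rabs_le_between in A1. apply Rabs_le_between in A2.
    split; nra. }
  apply Rabs_le. apply Rabs_le_between in L1. apply Rabs_le_between in L2.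
  split; nra.
Qed.

Section Bisection.

Variables (P Q : R -> R -> R) (x0 y0 w v : R).

Let mass (n : nat) (p : R * R) : R :=
  Rabs (circulation P Q (fst p) (snd p) (w / 2 ^ n) (v / 2 ^ n)).

(** Selects a quarter of the rectangle that carries at least a quarter of the mass. The fourth
    quarter is taken without a test: by the triangle inequality it qualifies when the other three do
    not. *)
Let next (n : nat) (p : R * R) : R * R :=
  let a := w / 2 ^ S n in
  let b := v / 2 ^ S n in
  let q1 := p in
  let q2 := (fst p + a, snd p) in
  let q3 := (fst p, snd p + b) in
  if Rle_dec (mass n p / 4) (mass (S n) q1) then q1 else
  if Rle_dec (mass n p / 4) (mass (S n) q2) then q2 else
  if Rle_dec (mass n p / 4) (mass (S n) q3) then q3 else
  (fst p + a, snd p + b).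

Fixpoint bisection (n : nat) : R * R :=
  match n with
  | O => (x0, y0)
  | S m => next m (bisection m)
  end.

Lemma bisection_step n :
  (fst (bisection (S n)) = fst (bisection n) \/
   fst (bisection (S n)) = fst (bisection n) + w / 2 ^ S n) /\
  (snd (bisection (S n)) = snd (bisection n) \/
   snd (bisection (S n)) = snd (bisection n) + v / 2 ^ S n).
Proof.
  cbn [bisection]. unfold next.
  repeat destruct Rle_dec; cbn [fst snd]; auto.
Qed.

Hypothesis Hw : 0 < w.
Hypothesis Hv : 0 < v.
Hypothesis HD : forall s t, x0 <= s <= x0 + w -> y0 <= t <= y0 + v ->
  closed_form_at P Q s t.

Lemma half_power (a : R) n : a / 2 ^ n = 2 * (a / 2 ^ S n).
Proof. simpl. field. apply pow_nonzero; lra. Qed.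

Lemma div_pow_pos (a : R) n : 0 < a -> 0 < a / 2 ^ n.
Proof. intro. apply Rdiv_lt_0_compat; [assumption|apply pow_lt; lra]. Qed.

Lemma bisection_range n :
  x0 <= fst (bisection n) /\ fst (bisection n) + w / 2 ^ n <= x0 + w /\
  y0 <= snd (bisection n) /\ snd (bisection n) + v / 2 ^ n <= y0 + v.
Proof.
  induction n.
  - simpl. lra.
  - destruct (bisection_step n) as [H1 H2].
    assert (A := half_power w n). assert (B := half_power v n).
    assert (A' := div_pow_pos w (S n) Hw). assert (B' := div_pow_pos v (S n) Hv).
    destruct H1 as [-> | ->], H2 as [-> | ->]; lra.
Qed.

Lemma bisection_mass n : mass 0 (x0, y0) <= 4 ^ n * mass n (bisection n).
Proof.
  induction n.
  - simpl. lra.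
  - assert (H : mass n (bisection n) / 4 <= mass (S n) (bisection (S n))).
    { destruct (bisection_range n) as (R1 & R2 & R3 & R4).
      assert (A := half_power w n). assert (B := half_power v n).
      assert (A' := div_pow_pos w (S n) Hw). assert (B' := div_pow_pos v (S n) Hv).
      assert (S4 := circulation_split P Q (fst (bisection n)) (snd (bisection n))
                      (w / 2 ^ S n) (v / 2 ^ S n) A' B').
      rewrite <- A, <- B in S4.
      assert (S4' := S4 (fun s t Hs Ht => HD s t (conj (Rle_trans _ _ _ R1 (proj1 Hs))
         (Rle_trans _ _ _ (proj2 Hs) R2)) (conj (Rle_trans _ _ _ R3 (proj1 Ht))
         (Rle_trans _ _ _ (proj2 Ht) R4)))). clear S4. rename S4' into S4.
      cbn [bisection]. unfold next.
      destruct Rle_dec as [?|N1]; [assumption|].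
      destruct Rle_dec as [?|N2]; [assumption|].
      destruct Rle_dec as [?|N3]; [assumption|].
      unfold mass in N1, N2, N3 |- *; cbn [fst snd] in N1, N2, N3 |- *.
      rewrite S4 in N1, N2, N3 |- *.
      assert (T : forall c1 c2 c3 c4, Rabs (c1 + c2 + c3 + c4) <=
        Rabs c1 + Rabs c2 + Rabs c3 + Rabs c4).
      { intros. do 3 (eapply Rle_trans; [apply Rabs_triang|]; apply Rplus_le_compat_r).
        lra. }
      specialize (T (circulation P Q (fst (bisection n)) (snd (bisection n)) (w / 2 ^ S n) (v / 2 ^ S n))
       (circulation P Q (fst (bisection n) + w / 2 ^ S n) (snd (bisection n)) (w / 2 ^ S n) (v / 2 ^ S n))
       (circulation P Q (fst (bisection n)) (snd (bisection n) + v / 2 ^ S n) (w / 2 ^ S n) (v / 2 ^ S n))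
       (circulation P Q (fst (bisection n) + w / 2 ^ S n) (snd (bisection n) + v / 2 ^ S n) (w / 2 ^ S n) (v / 2 ^ S n))).
      lra. }
    replace (4 ^ S n) with (4 * 4 ^ n) by (simpl; ring).
    assert (0 < 4 ^ n) by (apply pow_lt; lra). nra.
Qed.

Lemma nested_limit (a : nat -> R) (d : R) :
  0 < d -> (forall n, a n <= a (S n)) ->
  (forall n, a (S n) + d / 2 ^ S n <= a n + d / 2 ^ n) ->
  exists X, forall n, a n <= X <= a n + d / 2 ^ n.
Proof.
  intros Hd Hinc Hdec.
  assert (Hm : forall n k, a (n + k)%nat + d / 2 ^ (n + k) <= a n + d / 2 ^ n).
  { intros n k. induction k.
    - rewrite Nat.add_0_r. lra.
    - rewrite Nat.add_succ_r. specialize (Hdec (n + k)%nat). lra. }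
  assert (Hi : forall n k, a n <= a (n + k)%nat).
  { intros n k. induction k.
    - rewrite Nat.add_0_r. lra.
    - rewrite Nat.add_succ_r. specialize (Hinc (n + k)%nat). lra. }
  destruct (completeness (fun y => exists n, y = a n)) as [X [UB LUB]].
  - exists (a 0%nat + d). intros y [n ->]. specialize (Hm 0%nat n).
    assert (0 < d / 2 ^ n) by (apply div_pow_pos; assumption).
    simpl in Hm. replace (d / 1) with d in Hm by field. lra.
  - exists (a 0%nat). exists 0%nat. reflexivity.
  - exists X. intro n. split.
    + apply UB. exists n. reflexivity.
    + apply LUB. intros y [m ->].
      destruct (Nat.le_ge_cases n m) as [H|H].
      * replace m with (n + (m - n))%nat by lia. specialize (Hm n (m - n)%nat).
        assert (0 < d / 2 ^ (n + (m - n))) by (apply div_pow_pos; assumption). lra.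
      * specialize (Hi m (n - m)%nat). replace (m + (n - m))%nat with n in Hi by lia.
        assert (0 < d / 2 ^ n) by (apply div_pow_pos; assumption). lra.
Qed.

(** After n bisections the mass has dropped by at most a factor 4^n, while near the common point of
    the rectangles the circulation is at most e times a product of two lengths of order 2^-n. The
    powers cancel and e is arbitrary. *)
Lemma goursat_rectangle : circulation P Q x0 y0 w v = 0.
Proof.
  destruct (nested_limit (fun n => fst (bisection n)) w Hw) as [X HX].
  { intro n. destruct (bisection_step n) as [[-> | ->] _]; [lra|].
    assert (H := div_pow_pos w (S n) Hw). lra. }
  { intro n. assert (A := half_power w n). assert (A' := div_pow_pos w (S n) Hw).
    destruct (bisection_step n) as [[-> | ->] _]; lra. }
  destruct (nested_limit (fun n => snd (bisection n)) v Hv) as [Y HY].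
  { intro n. destruct (bisection_step n) as [_ [-> | ->]]; [lra|].
    assert (H := div_pow_pos v (S n) Hv). lra. }
  { intro n. assert (A := half_power v n). assert (A' := div_pow_pos v (S n) Hv).
    destruct (bisection_step n) as [_ [-> | ->]]; lra. }
  destruct (HD X Y) as (px & k & qy & HP & HQ).
  { specialize (HX 0%nat). simpl in HX. lra. }
  { specialize (HY 0%nat). simpl in HY. lra. }
  assert (Hall : forall e, 0 < e -> Rabs (circulation P Q x0 y0 w v) <= 2 * (w + v) * (w + v) * e).
  { intros e He.
    destruct (HP (mkposreal e He)) as [d1 H1].
    destruct (HQ (mkposreal e He)) as [d2 H2]. simpl in H1, H2.
    set (d := Rmin d1 d2).
    assert (Hd : 0 < d) by (apply Rmin_case; apply cond_pos).
    assert (Hd1 : d <= d1) by apply Rmin_l. assert (Hd2 : d <= d2) by apply Rmin_r.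
    destruct (pow_lt_1_zero (1 / 2)) with (y := d / (w + v)) as [N HN].
    { rewrite Rabs_right; lra. }
    { apply Rdiv_lt_0_compat; lra. }
    specialize (HN N (Nat.le_refl N)).
    assert (Hp : 0 < 2 ^ N) by (apply pow_lt; lra).
    assert (Hr : (w + v) / 2 ^ N < d).
    { rewrite Rabs_right in HN.
      2:{ apply Rle_ge, pow_le. lra. }
      replace ((1 / 2) ^ N) with (/ 2 ^ N) in HN.
      2:{ unfold Rdiv. rewrite Rmult_1_l, pow_inv. reflexivity. }
      apply Rmult_lt_compat_l with (r := w + v) in HN; [|lra].
      replace ((w + v) * (d / (w + v))) with d in HN by (field; lra).
      exact HN. }
    destruct (bisection_range N) as (R1 & R2 & R3 & R4).
    assert (A' := div_pow_pos w N Hw). assert (B' := div_pow_pos v N Hv).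
    assert (Hsum : (w + v) / 2 ^ N = w / 2 ^ N + v / 2 ^ N) by (field; lra).
    assert (Hs := circulation_small P Q (fst (bisection N)) (snd (bisection N))
       (w / 2 ^ N) (v / 2 ^ N) X Y e ((w + v) / 2 ^ N) px k qy A' B'
       (HX N) (HY N)).
    assert (HM := bisection_mass N). unfold mass in HM. cbn [fst snd] in HM.
    replace (w / 2 ^ 0) with w in HM by (simpl; field).
    replace (v / 2 ^ 0) with v in HM by (simpl; field).
    eapply Rle_trans; [exact HM|].
    eapply Rle_trans.
    - apply Rmult_le_compat_l; [apply pow_le; lra|]. apply Hs; try lra.
      + intros; apply HD; lra.
      + intros s t Hs1 Ht1.
        assert (Rmax (Rabs (s - X)) (Rabs (t - Y)) <= (w + v) / 2 ^ N) by (apply Rmax_lub; lra).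
        split.
        * eapply Rle_trans; [apply H1; lra|]. apply Rmult_le_compat_l; lra.
        * eapply Rle_trans; [apply H2; lra|]. apply Rmult_le_compat_l; lra.
    - right. replace 4 with (2 * 2) by ring. rewrite Rpow_mult_distr. field. lra. }
  destruct (Req_dec (circulation P Q x0 y0 w v) 0) as [|Hne]; [assumption|exfalso].
  apply Rabs_pos_lt in Hne.
  set (K := 2 * (w + v) * (w + v)) in *. assert (HK : 0 < K) by (unfold K; nra).
  specialize (Hall (Rabs (circulation P Q x0 y0 w v) / (2 * K))).
  assert (0 < Rabs (circulation P Q x0 y0 w v) / (2 * K)) by (apply Rdiv_lt_0_compat; lra).
  specialize (Hall H).
  replace (K * (Rabs (circulation P Q x0 y0 w v) / (2 * K))) with
    (Rabs (circulation P Q x0 y0 w v) / 2) in Hall by (field; lra).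
  lra.
Qed.

End Bisection.

(** * Complex differentiability and compactness *)

Notation Cx := Complex.C.

Lemma Cmod_minus_sym (z w : Cx) : Cmod (z - w) = Cmod (w - z).
Proof. rewrite <- Cmod_opp. f_equal. ring. Qed.

Lemma Cmod_minus_triangle (z w u : Cx) : Cmod (z - u) <= Cmod (z - w) + Cmod (w - u).
Proof. replace (z - u)%C with ((z - w) + (w - u))%C by ring. apply Cmod_triangle. Qed.

Lemma Cmod_le_plus (z w : Cx) : Cmod z <= Cmod w + Cmod (z - w).
Proof. replace z with (w + (z - w))%C at 1 by ring. apply Cmod_triangle. Qed.

Lemma Cmod_minus_le (z w : Cx) : Cmod (z - w) <= Cmod z + Cmod w.
Proof. rewrite <- (Cmod_opp w). apply Cmod_triangle. Qed.

Lemma Cmod_minus_eq_0 (z w : Cx) : Cmod (z - w) = 0 -> z = w.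
Proof.
  intro H. apply Cmod_eq_0 in H. replace z with ((z - w) + w)%C by ring.
  rewrite H. ring.
Qed.

Lemma Cmod_minus_pos (z w : Cx) : z <> w -> 0 < Cmod (z - w).
Proof.
  intro H. destruct (Cmod_ge_0 (z - w)) as [|E]; [assumption|].
  symmetry in E. apply Cmod_minus_eq_0 in E. contradiction.
Qed.

Lemma Cminus_neq_0 (z w : Cx) : z <> w -> (z - w <> 0)%C.
Proof. intros H E. apply H, Cmod_minus_eq_0. rewrite E. apply Cmod_0. Qed.

Lemma Cmod_self_minus (z : Cx) : Cmod (z - z) = 0.
Proof. replace (z - z)%C with (RtoC 0) by ring. apply Cmod_0. Qed.

Lemma Cmod_fst (z : Cx) : Rabs (fst z) <= Cmod z.
Proof. eapply Rle_trans; [apply Rmax_l|apply Rmax_Cmod]. Qed.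

Lemma Cmod_snd (z : Cx) : Rabs (snd z) <= Cmod z.
Proof. eapply Rle_trans; [apply Rmax_r|apply Rmax_Cmod]. Qed.

Lemma Cmod_le_abs (z : Cx) : Cmod z <= Rabs (fst z) + Rabs (snd z).
Proof.
  unfold Cmod. assert (A := Rabs_pos (fst z)). assert (B := Rabs_pos (snd z)).
  rewrite <- (sqrt_pow2 (Rabs (fst z) + Rabs (snd z))) by lra.
  apply sqrt_le_1_alt. rewrite <- (pow2_abs (fst z)), <- (pow2_abs (snd z)). nra.
Qed.

Definition contC (F : Cx -> Cx) (z : Cx) : Prop :=
  forall eps, 0 < eps -> exists d, 0 < d /\
    forall w, Cmod (w - z) < d -> Cmod (F w - F z) < eps.

(* Caratheodory's form of complex differentiability: the difference quotient extends continuously. *)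
Definition holC (F : Cx -> Cx) (z : Cx) : Prop :=
  exists Phi : Cx -> Cx, contC Phi z /\ forall w, (F w - F z = Phi w * (w - z))%C.

Lemma contC_ext_loc F G z d :
  0 < d -> (forall w, Cmod (w - z) < d -> F w = G w) -> contC F z -> contC G z.
Proof.
  intros Hd E H eps He. destruct (H eps He) as (d1 & Hd1 & H1).
  exists (Rmin d d1). split; [apply Rmin_case; assumption|].
  intros w Hw. rewrite <- !E.
  - apply H1. eapply Rlt_le_trans; [exact Hw|apply Rmin_r].
  - rewrite Cmod_self_minus. assumption.
  - eapply Rlt_le_trans; [exact Hw|apply Rmin_l].
Qed.

Lemma contC_const c z : contC (fun _ => c) z.
Proof.
  intros eps He. exists 1. split; [lra|]. intros. rewrite Cmod_self_minus. assumption.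
Qed.

Lemma contC_id z : contC (fun w => w) z.
Proof. intros eps He. exists eps. auto. Qed.

Lemma contC_plus F G z : contC F z -> contC G z -> contC (fun w => F w + G w)%C z.
Proof.
  intros HF HG eps He.
  destruct (HF (eps / 2)) as (d1 & Hd1 & H1); [lra|].
  destruct (HG (eps / 2)) as (d2 & Hd2 & H2); [lra|].
  exists (Rmin d1 d2). split; [apply Rmin_case; assumption|]. intros w Hw.
  assert (A := Rmin_l d1 d2). assert (B := Rmin_r d1 d2).
  specialize (H1 w ltac:(lra)). specialize (H2 w ltac:(lra)).
  replace (F w + G w - (F z + G z))%C with ((F w - F z) + (G w - G z))%C by ring.
  eapply Rle_lt_trans; [apply Cmod_triangle|]. lra.
Qed.

Lemma contC_mult F G z : contC F z -> contC G z -> contC (fun w => F w * G w)%C z.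
Proof.
  intros HF HG eps He.
  assert (PF := Cmod_ge_0 (F z)). assert (PG := Cmod_ge_0 (G z)).
  set (K := 1 + Cmod (F z) + Cmod (G z)).
  assert (HK : 0 < K) by (unfold K; lra).
  assert (Hq : 0 < eps / (2 * K)) by (apply Rdiv_lt_0_compat; lra).
  set (e := Rmin 1 (eps / (2 * K))).
  assert (0 < e) by (apply Rmin_case; lra).
  assert (e <= 1) by apply Rmin_l. assert (He2 : e <= eps / (2 * K)) by apply Rmin_r.
  destruct (HF e) as (d1 & Hd1 & H1); [lra|].
  destruct (HG e) as (d2 & Hd2 & H2); [lra|].
  exists (Rmin d1 d2). split; [apply Rmin_case; assumption|]. intros w Hw.
  assert (A := Rmin_l d1 d2). assert (B := Rmin_r d1 d2).
  specialize (H1 w ltac:(lra)). specialize (H2 w ltac:(lra)).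
  replace (F w * G w - F z * G z)%C
    with ((F w - F z) * (G w - G z) + ((F w - F z) * G z + F z * (G w - G z)))%C by ring.
  eapply Rle_lt_trans; [apply Cmod_triangle|].
  eapply Rle_lt_trans; [apply Rplus_le_compat_l, Cmod_triangle|].
  rewrite !Cmod_mult.
  assert (P1 := Cmod_ge_0 (F w - F z)). assert (P2 := Cmod_ge_0 (G w - G z)).
  assert (e * K <= eps / 2).
  { replace (eps / 2) with (eps / (2 * K) * K) by (field; lra).
    apply Rmult_le_compat_r; lra. }
  unfold K in *. nra.
Qed.

Lemma contC_opp F z : contC F z -> contC (fun w => - F w)%C z.
Proof.
  intros HF eps He. destruct (HF eps He) as (d & Hd & H). exists d. split; [assumption|].
  intros w Hw. replace (- F w - - F z)%C with (- (F w - F z))%C by ring.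
  rewrite Cmod_opp. auto.
Qed.

Lemma contC_minus F G z : contC F z -> contC G z -> contC (fun w => F w - G w)%C z.
Proof. intros. apply contC_plus; [assumption|]. apply contC_opp. assumption. Qed.

Lemma contC_neq_0 F z : contC F z -> F z <> 0%C ->
  exists d, 0 < d /\ forall w, Cmod (w - z) < d -> Cmod (F z) / 2 < Cmod (F w).
Proof.
  intros HF Hz. apply Cmod_gt_0 in Hz.
  destruct (HF (Cmod (F z) / 2)) as (d & Hd & H); [lra|].
  exists d. split; [assumption|]. intros w Hw. specialize (H w Hw).
  assert (T := Cmod_le_plus (F z) (F w)). rewrite Cmod_minus_sym in T. lra.
Qed.

Lemma contC_inv F z : contC F z -> F z <> 0%C -> contC (fun w => / F w)%C z.
Proof.
  intros HF Hz eps He. assert (Hp := Hz). apply Cmod_gt_0 in Hp.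
  destruct (contC_neq_0 F z HF Hz) as (d1 & Hd1 & H1).
  set (m := Cmod (F z)) in *.
  destruct (HF (eps * (m * m / 2))) as (d2 & Hd2 & H2).
  { apply Rmult_lt_0_compat; nra. }
  exists (Rmin d1 d2). split; [apply Rmin_case; assumption|]. intros w Hw.
  assert (A := Rmin_l d1 d2). assert (B := Rmin_r d1 d2).
  specialize (H1 w ltac:(lra)). specialize (H2 w ltac:(lra)).
  assert (Hw0 : F w <> 0%C) by (apply Cmod_gt_0; lra).
  replace (/ F w - / F z)%C with (- (F w - F z) / (F w * F z))%C by (field; auto).
  rewrite Cmod_div, Cmod_opp, Cmod_mult by (apply Cmult_neq_0; assumption).
  fold m. apply Rmult_lt_reg_r with (Cmod (F w) * m); [nra|].
  unfold Rdiv. rewrite Rmult_assoc, Rinv_l by nra. rewrite Rmult_1_r.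
  eapply Rlt_trans; [exact H2|]. apply Rmult_lt_compat_l; [assumption|].
  replace (m * m / 2) with (m / 2 * m) by field. apply Rmult_lt_compat_r; assumption.
Qed.

Lemma holC_contC F z : holC F z -> contC F z.
Proof.
  intros (Phi & HP & E).
  apply contC_ext_loc with (F := fun w => (F z + Phi w * (w - z))%C) (d := 1); [lra| |].
  - intros w _. rewrite <- E. ring.
  - apply contC_plus; [apply contC_const|].
    apply contC_mult; [assumption|].
    apply contC_minus; [apply contC_id|apply contC_const].
Qed.

(** [holC] wants a factorisation at every w; away from z the difference quotient always provides
    one, so only a neighbourhood of z matters. *)
Lemma holC_local F z Phi d :
  0 < d -> contC Phi z ->
  (forall w, Cmod (w - z) < d -> (F w - F z = Phi w * (w - z))%C) -> holC F z.
Proof.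
  intros Hd HP E.
  exists (fun w => if excluded_middle_informative (w = z) then Phi z
                   else ((F w - F z) / (w - z))%C). split.
  - apply contC_ext_loc with (F := Phi) (d := d); [assumption| |assumption].
    intros w Hw. destruct excluded_middle_informative as [->|N]; [reflexivity|].
    rewrite E by assumption. field. apply Cminus_neq_0. assumption.
  - intros w. destruct excluded_middle_informative as [->|N]; [ring|].
    field. apply Cminus_neq_0. assumption.
Qed.

Lemma holC_ext_loc F G z d :
  0 < d -> (forall w, Cmod (w - z) < d -> F w = G w) -> holC F z -> holC G z.
Proof.
  intros Hd E (Phi & HP & H). apply holC_local with Phi d; try assumption.
  intros w Hw. rewrite <- !E; [apply H| |assumption].
  rewrite Cmod_self_minus. assumption.
Qed.

Lemma holC_const c z : holC (fun _ => c) z.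
Proof. exists (fun _ => RtoC 0). split; [apply contC_const|]. intros; ring. Qed.

Lemma holC_id z : holC (fun w => w) z.
Proof. exists (fun _ => RtoC 1). split; [apply contC_const|]. intros; ring. Qed.

Lemma holC_minus F G z : holC F z -> holC G z -> holC (fun w => F w - G w)%C z.
Proof.
  intros (P & HP & E) (Q & HQ & E'). exists (fun w => P w - Q w)%C.
  split; [apply contC_minus; assumption|]. intro w.
  replace (F w - G w - (F z - G z))%C with ((F w - F z) - (G w - G z))%C by ring.
  rewrite E, E'. ring.
Qed.

Lemma holC_mult F G z : holC F z -> holC G z -> holC (fun w => F w * G w)%C z.
Proof.
  intros HF HG. assert (CG := holC_contC _ _ HG).
  destruct HF as (P & HP & E). destruct HG as (Q & HQ & E').
  exists (fun w => P w * G w + F z * Q w)%C. split.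
  - apply contC_plus; apply contC_mult; try assumption. apply contC_const.
  - intro w. replace (F w * G w - F z * G z)%C
      with ((F w - F z) * G w + F z * (G w - G z))%C by ring.
    rewrite E, E'. ring.
Qed.

Lemma holC_inv F z : holC F z -> F z <> 0%C -> holC (fun w => / F w)%C z.
Proof.
  intros HF Hz. assert (CF := holC_contC _ _ HF).
  destruct (contC_neq_0 F z CF Hz) as (d & Hd & H).
  destruct HF as (P & HP & E).
  apply holC_local with (fun w => - P w * / (F w * F z))%C d; [assumption| |].
  - apply contC_mult; [apply contC_opp; assumption|].
    apply contC_inv; [|apply Cmult_neq_0; assumption].
    apply contC_mult; [assumption|apply contC_const].
  - intros w Hw. specialize (H w Hw). apply Cmod_gt_0 in Hz.
    assert (Hw0 : F w <> 0%C) by (apply Cmod_gt_0; lra). apply Cmod_gt_0 in Hz.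
    replace (- P w * / (F w * F z) * (w - z))%C
      with (- (P w * (w - z)) * / (F w * F z))%C by ring.
    rewrite <- E. field. auto.
Qed.

Lemma holC_div F G z : holC F z -> holC G z -> G z <> 0%C -> holC (fun w => F w / G w)%C z.
Proof. intros. apply holC_mult; [assumption|]. apply holC_inv; assumption. Qed.

Lemma holC_translate F h z : holC F (z + h)%C -> holC (fun w => F (w + h)%C) z.
Proof.
  intros (P & HP & E). exists (fun w => P (w + h)%C). split.
  - intros eps He. destruct (HP eps He) as (d & Hd & H). exists d. split; [assumption|].
    intros w Hw. apply H. replace (w + h - (z + h))%C with (w - z)%C by ring. assumption.
  - intro w. rewrite E. f_equal. ring.
Qed.

(** Away from p the factor [Phi] agrees locally with the explicit quotient. Nothing is claimed at p
    itself, where only continuity of [Phi] is at hand. *)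
Lemma difference_quotient_hol F p Phi z :
  (forall w, F w - F p = Phi w * (w - p))%C -> z <> p -> holC F z -> holC Phi z.
Proof.
  intros E Hz HF.
  apply holC_ext_loc with (F := fun w => ((F w - F p) / (w - p))%C) (d := Cmod (z - p)).
  - apply Cmod_minus_pos. assumption.
  - intros w Hw. rewrite E. field. intro A.
    assert (B : w = p) by (apply Cmod_minus_eq_0; rewrite A; apply Cmod_0).
    subst. rewrite Cmod_minus_sym in Hw. lra.
  - apply holC_div; [| |apply Cminus_neq_0; assumption];
      (apply holC_minus; [|apply holC_const]); [assumption|apply holC_id].
Qed.

(** * Subsequences and compactness of closed discs *)

Definition increasing_seq (phi : nat -> nat) : Prop := forall n, (phi n < phi (S n))%nat.

Lemma increasing_seq_lt phi : increasing_seq phi -> forall m n, (m < n)%nat -> (phi m < phi n)%nat.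
Proof. intros H m n Hmn. induction Hmn; [apply H|]. specialize (H m0). lia. Qed.

Lemma increasing_seq_ge phi : increasing_seq phi -> forall n, (n <= phi n)%nat.
Proof. intros H n. induction n; [lia|]. specialize (H n). lia. Qed.

Lemma increasing_seq_comp phi psi :
  increasing_seq phi -> increasing_seq psi -> increasing_seq (fun n => phi (psi n)).
Proof. intros H1 H2 n. apply increasing_seq_lt; [assumption|apply H2]. Qed.

Lemma extraction (A : nat -> nat -> Prop) :
  (forall n N, exists p, (N <= p)%nat /\ A n p) ->
  exists phi, increasing_seq phi /\ forall n, A n (phi n).
Proof.
  intros H.
  set (g := fun n N => proj1_sig (constructive_indefinite_description _ (H n N))).
  assert (Hg : forall n N, (N <= g n N)%nat /\ A n (g n N)).
  { intros. unfold g. apply (proj2_sig (constructive_indefinite_description _ (H n N))). }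
  exists (fix phi n := match n with O => g 0%nat 0%nat | S m => g (S m) (S (phi m)) end).
  split.
  - intro n. apply Nat.lt_le_trans with (2 := proj1 (Hg (S n) _)). lia.
  - intros [|n]; apply Hg.
Qed.

Lemma seq_choice {T : Type} (A : nat -> T -> Prop) :
  (forall n, exists x, A n x) -> exists u : nat -> T, forall n, A n (u n).
Proof.
  intro H. exists (fun n => proj1_sig (constructive_indefinite_description _ (H n))).
  intro n. apply (proj2_sig (constructive_indefinite_description _ (H n))).
Qed.

Lemma inv_INR_pos n : 0 < / (INR n + 1).
Proof. apply Rinv_0_lt_compat. assert (H := pos_INR n). lra. Qed.

Lemma inv_INR_small eps : 0 < eps -> exists N, forall n, (N <= n)%nat -> / (INR n + 1) < eps.
Proof.
  intro He. destruct (INR_unbounded (/ eps)) as [N HN]. exists N. intros n Hn.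
  apply le_INR in Hn. assert (0 < / eps) by (apply Rinv_0_lt_compat; lra).
  rewrite <- (Rinv_inv eps). apply Rinv_lt_contravar; [|lra].
  apply Rmult_lt_0_compat; [assumption|]. assert (P := pos_INR n). lra.
Qed.

Lemma bolzano_weierstrass_R (u : nat -> R) M :
  (forall n, Rabs (u n) <= M) ->
  exists phi l, increasing_seq phi /\
    forall eps, 0 < eps -> exists N, forall n, (N <= n)%nat -> Rabs (u (phi n) - l) < eps.
Proof.
  intro H.
  destruct (Bolzano_Weierstrass u (fun x => - M <= x <= M)) as [l Hl].
  { apply compact_P3. }
  { intro n. apply Rabs_le_between. apply H. }
  destruct (extraction (fun n p => Rabs (u p - l) < / (INR n + 1))) as (phi & Hp & HA).
  { intros n N. apply (Hl (fun x => Rabs (x - l) < / (INR n + 1)) N).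
    exists (mkposreal _ (inv_INR_pos n)). intros x Hx. exact Hx. }
  exists phi, l. split; [assumption|]. intros eps He.
  destruct (inv_INR_small eps He) as [N HN]. exists N. intros n Hn.
  eapply Rlt_trans; [apply HA|]. apply HN. assumption.
Qed.

Lemma bolzano_weierstrass_C (u : nat -> Cx) M :
  (forall n, Cmod (u n) <= M) ->
  exists phi l, increasing_seq phi /\
    forall eps, 0 < eps -> exists N, forall n, (N <= n)%nat -> Cmod (u (phi n) - l) < eps.
Proof.
  intro H.
  destruct (bolzano_weierstrass_R (fun n => fst (u n)) M) as (phi & l1 & Hphi & H1).
  { intro n. eapply Rle_trans; [apply Cmod_fst|apply H]. }
  destruct (bolzano_weierstrass_R (fun n => snd (u (phi n))) M) as (psi & l2 & Hpsi & H2).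
  { intro n. eapply Rle_trans; [apply Cmod_snd|apply H]. }
  exists (fun n => phi (psi n)), (l1, l2).
  split; [apply increasing_seq_comp; assumption|]. intros eps He.
  destruct (H1 (eps / 2)) as [N1 HN1]; [lra|].
  destruct (H2 (eps / 2)) as [N2 HN2]; [lra|].
  exists (Nat.max N1 N2). intros n Hn.
  eapply Rle_lt_trans; [apply Cmod_le_abs|]. simpl.
  assert (P := increasing_seq_ge _ Hpsi n).
  specialize (HN1 (psi n) ltac:(lia)). specialize (HN2 n ltac:(lia)).
  unfold Rminus in *. lra.
Qed.

Lemma bolzano_weierstrass_disc (u : nat -> Cx) c M :
  (forall n, Cmod (u n - c) <= M) ->
  exists phi l, increasing_seq phi /\ Cmod (l - c) <= M /\
    forall eps, 0 < eps -> exists N, forall n, (N <= n)%nat -> Cmod (u (phi n) - l) < eps.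
Proof.
  intro H. destruct (bolzano_weierstrass_C u (Cmod c + M)) as (phi & l & H1 & H2).
  { intro n. eapply Rle_trans; [apply (Cmod_le_plus _ c)|]. specialize (H n). lra. }
  exists phi, l. split; [assumption|]. split; [|assumption].
  apply le_epsilon. intros eps He. destruct (H2 eps He) as [N HN].
  specialize (HN N (Nat.le_refl N)). specialize (H (phi N)).
  assert (T := Cmod_minus_triangle l (u (phi N)) c). rewrite Cmod_minus_sym in HN. lra.
Qed.

Lemma continuous_attains_max (W : Cx -> R) c r :
  0 <= r ->
  (forall z, Cmod (z - c) <= r -> forall eps, 0 < eps -> exists d, 0 < d /\
     forall w, Cmod (w - z) < d -> Rabs (W w - W z) < eps) ->
  exists p, Cmod (p - c) <= r /\ forall z, Cmod (z - c) <= r -> W z <= W p.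
Proof.
  intros Hr HW.
  assert (Hc : Cmod (c - c) <= r) by (rewrite Cmod_self_minus; assumption).
  assert (Bd : exists K, forall z, Cmod (z - c) <= r -> W z <= K).
  { apply NNPP. intro N.
    destruct (seq_choice (fun n z => Cmod (z - c) <= r /\ INR n < W z)) as [u Hu].
    { intro n. apply NNPP. intro N'. apply N. exists (INR n). intros z Hz.
      apply Rnot_lt_le. intro. apply N'. exists z. auto. }
    destruct (bolzano_weierstrass_disc u c r) as (phi & l & Hphi & Hl & Hlim).
    { intro n. apply Hu. }
    destruct (HW l Hl 1) as (d & Hd & Hcont); [lra|].
    destruct (Hlim d Hd) as [N1 HN1].
    destruct (INR_unbounded (W l + 1)) as [N2 HN2].
    set (n := Nat.max N1 N2).
    specialize (HN1 n ltac:(unfold n; lia)). apply Hcont in HN1.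
    apply Rabs_def2 in HN1. destruct (Hu (phi n)) as [_ Hn].
    assert (Hge := increasing_seq_ge _ Hphi n).
    assert (INR N2 <= INR (phi n)) by (apply le_INR; unfold n in *; lia). lra. }
  destruct Bd as [K HK].
  destruct (completeness (fun y => exists z, Cmod (z - c) <= r /\ y = W z)) as [m [UB LUB]].
  { exists K. intros y (z & Hz & ->). auto. }
  { exists (W c), c. auto. }
  destruct (seq_choice (fun n z => Cmod (z - c) <= r /\ m - / (INR n + 1) < W z)) as [u Hu].
  { intro n. apply NNPP. intro N. assert (P := inv_INR_pos n).
    assert (m <= m - / (INR n + 1)); [|lra].
    apply LUB. intros y (z & Hz & ->). apply Rnot_lt_le. intro. apply N. exists z. auto. }
  destruct (bolzano_weierstrass_disc u c r) as (phi & l & Hphi & Hl & Hlim).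
  { intro n. apply Hu. }
  exists l. split; [assumption|]. intros z Hz.
  apply Rle_trans with m; [apply UB; exists z; auto|].
  apply le_epsilon. intros eps He.
  destruct (HW l Hl (eps / 2)) as (d & Hd & Hcont); [lra|].
  destruct (Hlim d Hd) as [N1 HN1].
  destruct (inv_INR_small (eps / 2)) as [N2 HN2]; [lra|].
  set (n := Nat.max N1 N2).
  specialize (HN1 n ltac:(unfold n; lia)). apply Hcont in HN1. apply Rabs_def2 in HN1.
  assert (Hge := increasing_seq_ge _ Hphi n).
  specialize (HN2 (phi n) ltac:(unfold n in *; lia)). destruct (Hu (phi n)) as [_ Hn]. lra.
Qed.

(** * The maximum principle *)

Definition polar (p : Cx) (s t : R) : Cx := (fst p + s * cos t, snd p + s * sin t).

Lemma polar_minus p s t : (polar p s t - p)%C = (s * cos t, s * sin t).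
Proof. unfold polar, Cminus, Cplus, Copp. simpl. f_equal; ring. Qed.

Lemma Cmod_polar p s t : 0 <= s -> Cmod (polar p s t - p) = s.
Proof.
  intro Hs. rewrite polar_minus. unfold Cmod. simpl fst; simpl snd.
  replace ((s * cos t) ^ 2 + (s * sin t) ^ 2) with (s ^ 2 * (Rsqr (sin t) + Rsqr (cos t)))
    by (unfold Rsqr; ring).
  rewrite sin2_cos2, Rmult_1_r. apply sqrt_pow2. assumption.
Qed.

Lemma differentiable_pt_lim_mult x y : differentiable_pt_lim (fun u v => u * v) x y y x.
Proof.
  intros eps. exists eps. intros u v Hu Hv.
  replace (u * v - x * y - (y * (u - x) + x * (v - y))) with ((u - x) * (v - y)) by ring.
  rewrite Rabs_mult. apply Rmult_le_compat; try apply Rabs_pos; [lra|apply Rmax_r].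
Qed.

Lemma differentiable_pt_lim_fst f x y l :
  is_derive f x l -> differentiable_pt_lim (fun u _ => f u) x y l 0.
Proof. intro H. apply differentiable_pt_lim_proj1_0. apply is_derive_Reals. assumption. Qed.

Lemma differentiable_pt_lim_snd f x y l :
  is_derive f y l -> differentiable_pt_lim (fun _ v => f v) x y 0 l.
Proof.
  intro H.
  assert (S : differentiable_pt_lim (fun _ v => v) x y 0 1).
  { intros eps. exists eps. intros u v _ _.
    replace (v - y - (0 * (u - x) + 1 * (v - y))) with 0 by ring. rewrite Rabs_R0.
    apply Rmult_le_pos; [apply Rlt_le, cond_pos|].
    eapply Rle_trans; [apply Rabs_pos|apply Rmax_l]. }
  assert (K := differentiable_pt_lim_comp (fun u _ => f u) (fun _ v => v) (fun _ v => v)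
    x y l 0 0 1 0 1 (differentiable_pt_lim_fst f y y l H) S S).
  replace 0 with (l * 0 + 0 * 0) by ring. replace l with (l * 1 + 0 * 1) at 2 by ring. exact K.
Qed.

Lemma differentiable_pt_lim_value f x y lx ly lx' ly' :
  differentiable_pt_lim f x y lx ly -> lx = lx' -> ly = ly' ->
  differentiable_pt_lim f x y lx' ly'.
Proof. intros; subst; assumption. Qed.

Lemma differentiable_pt_lim_prod f g x y fx fy gx gy :
  differentiable_pt_lim f x y fx fy -> differentiable_pt_lim g x y gx gy ->
  differentiable_pt_lim (fun u v => f u v * g u v) x y
    (g x y * fx + f x y * gx) (g x y * fy + f x y * gy).
Proof.
  intros Hf Hg. apply (differentiable_pt_lim_comp (fun a b => a * b)); [|assumption|assumption].
  apply differentiable_pt_lim_mult.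
Qed.

Lemma differentiable_pt_lim_radial a f s t l :
  is_derive f t l -> differentiable_pt_lim (fun s t => a + s * f t) s t (f t) (s * l).
Proof.
  intro Hf.
  assert (D : differentiable_pt_lim (fun s t => s * f t) s t (f t * 1 + s * 0) (f t * 0 + s * l)).
  { apply (differentiable_pt_lim_prod (fun s _ => s) (fun _ t => f t)).
    - apply (differentiable_pt_lim_fst (fun s => s)). auto_derive; [trivial|reflexivity].
    - apply differentiable_pt_lim_snd. assumption. }
  eapply differentiable_pt_lim_value.
  - apply (differentiable_pt_lim_comp (fun b _ => a + b) (fun s t => s * f t)
      (fun s t => s * f t)); [|exact D|exact D].
    apply (differentiable_pt_lim_fst (fun b => a + b) (s * f t) (s * f t) 1).
    auto_derive; [trivial|ring].
  - ring.
  - ring.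
Qed.

(** The Cauchy-Riemann equations, with A + iB = [Phi z]; the error of the linear approximation is
    (Phi(w) - Phi(z)) (w - z). *)
Lemma holC_real_differentiable F z :
  holC F z -> exists A B,
    differentiable_pt_lim (fun x y => fst (F (x, y))) (fst z) (snd z) A (- B) /\
    differentiable_pt_lim (fun x y => snd (F (x, y))) (fst z) (snd z) B A.
Proof.
  intros (P & HP & E). exists (fst (P z)), (snd (P z)).
  assert (K : forall eps : posreal, exists d : posreal, forall u v,
     Rabs (u - fst z) < d -> Rabs (v - snd z) < d ->
     Cmod (F (u, v) - F z - P z * ((u, v) - z)) <= eps * Rmax (Rabs (u - fst z)) (Rabs (v - snd z))).
  { intros eps. destruct (HP (eps / 2)) as (d & Hd & H).
    { assert (C := cond_pos eps). lra. }
    assert (Hd2 : 0 < d / 2) by lra. exists (mkposreal _ Hd2). simpl. intros u v Hu Hv.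
    assert (L : Cmod ((u, v) - z) <= Rabs (u - fst z) + Rabs (v - snd z)).
    { eapply Rle_trans; [apply Cmod_le_abs|]. simpl. right. reflexivity. }
    rewrite E. replace (P (u, v) * ((u, v) - z) - P z * ((u, v) - z))%C
      with ((P (u, v) - P z) * ((u, v) - z))%C by ring.
    rewrite Cmod_mult. specialize (H (u, v) ltac:(lra)).
    assert (A := Rmax_l (Rabs (u - fst z)) (Rabs (v - snd z))).
    assert (B := Rmax_r (Rabs (u - fst z)) (Rabs (v - snd z))).
    assert (C := cond_pos eps).
    apply Rle_trans with (eps / 2 * (2 * Rmax (Rabs (u - fst z)) (Rabs (v - snd z)))).
    2:{ right. field. }
    apply Rmult_le_compat; try apply Cmod_ge_0; lra. }
  split; intros eps; destruct (K eps) as [d Hd]; exists d; intros u v Hu Hv;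
    (eapply Rle_trans; [|apply (Hd u v Hu Hv)]).
  - eapply Rle_trans; [|apply Cmod_fst]. right. f_equal.
    destruct z; simpl; ring.
  - eapply Rle_trans; [|apply Cmod_snd]. right. f_equal.
    destruct z; simpl; ring.
Qed.

(* The form Re(F dz / (i (z - p))) in polar coordinates around p. *)
Lemma polar_closed_form F p s t :
  0 < s -> holC F (polar p s t) ->
  closed_form_at (fun s t => snd (F (polar p s t)) * / s)
                 (fun s t => fst (F (polar p s t))) s t.
Proof.
  intros Hs HF.
  destruct (holC_real_differentiable _ _ HF) as (A & B & HU & HV).
  assert (DX : differentiable_pt_lim (fun s t => fst p + s * cos t) s t (cos t) (s * - sin t)).
  { apply differentiable_pt_lim_radial. auto_derive; [trivial|ring]. }
  assert (DY : differentiable_pt_lim (fun s t => snd p + s * sin t) s t (sin t) (s * cos t)).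
  { apply differentiable_pt_lim_radial. auto_derive; [trivial|ring]. }
  assert (CU := differentiable_pt_lim_comp _ _ _ _ _ _ _ _ _ _ _ HU DX DY).
  assert (CV := differentiable_pt_lim_comp _ _ _ _ _ _ _ _ _ _ _ HV DX DY).
  assert (CI : differentiable_pt_lim (fun s _ => / s) s t (- / s ^ 2) 0).
  { apply (differentiable_pt_lim_fst (fun s => / s)). auto_derive; [lra|]. field. lra. }
  assert (CP := differentiable_pt_lim_prod _ _ _ _ _ _ _ _ CV CI).
  eexists _, _, _. split.
  - exact CP.
  (* The angular derivative of Im F / s is A cos t - B sin t, which is also the radial derivative of
     Re F. *)
  - eapply differentiable_pt_lim_value; [exact CU| |reflexivity].
    field. lra.
Qed.

Lemma RInt_const_R (c a b : R) : RInt (fun _ => c) a b = (b - a) * c :> R.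
Proof. rewrite (RInt_const (V := R_CompleteNormedModule)). reflexivity. Qed.

Lemma contC_circle_continuous F p r t :
  contC F (polar p r t) -> 0 <= r -> continuous (fun t => fst (F (polar p r t))) t.
Proof.
  intros HF Hr. apply continuity_pt_filterlim.
  intros eps He. destruct (HF eps He) as (d & Hd & H).
  set (e := d / (2 * (r + 1))).
  assert (Hee : 0 < e) by (apply Rdiv_lt_0_compat; lra).
  assert (Hre : 2 * r * e < d).
  { assert (E : 2 * (r + 1) * e = d) by (unfold e; field; lra). nra. }
  destruct (continuity_cos t e Hee) as (d1 & Hd1 & H1).
  destruct (continuity_sin t e Hee) as (d2 & Hd2 & H2).
  exists (Rmin d1 d2). split; [apply Rmin_case; assumption|].
  intros x [Hx Hxt]. simpl in *. unfold R_dist in *.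
  assert (A := Rmin_l d1 d2). assert (B := Rmin_r d1 d2).
  assert (C1 := H1 x (conj Hx (Rlt_le_trans _ _ _ Hxt A))).
  assert (C2 := H2 x (conj Hx (Rlt_le_trans _ _ _ Hxt B))). simpl in C1, C2.
  unfold R_dist in C1, C2.
  eapply Rle_lt_trans; [|apply (H (polar p r x))].
  - exact (Cmod_fst (F (polar p r x) - F (polar p r t))%C).
  - eapply Rle_lt_trans; [apply Cmod_le_abs|].
    replace (fst (polar p r x - polar p r t)%C) with (r * (cos x - cos t)) by (simpl; ring).
    replace (snd (polar p r x - polar p r t)%C) with (r * (sin x - sin t)) by (simpl; ring).
    rewrite !Rabs_mult, (Rabs_right r) by lra. nra.
Qed.

(** Goursat on the rectangle [s, r] x [0, 2 pi] in polar coordinates: the sides t = 0 and t = 2 pi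
    cancel by periodicity, so the circle average does not depend on the radius. As s tends to 0 it
    tends to the value at p, by continuity there. *)
Lemma mean_value F p r :
  0 < r -> contC F p -> (forall z, 0 < Cmod (z - p) <= r -> holC F z) ->
  ex_RInt (fun t => fst (F (polar p r t))) 0 (2 * PI) /\
  RInt (fun t => fst (F (polar p r t))) 0 (2 * PI) = 2 * PI * fst (F p).
Proof.
  intros Hr HC HH. assert (Hpi := PI_RGT_0).
  assert (EX : forall s, 0 < s <= r -> ex_RInt (fun t => fst (F (polar p s t))) 0 (2 * PI)).
  { intros s Hs. apply ex_RInt_cont; [lra|]. intros t _. apply contC_circle_continuous; [|lra].
    apply holC_contC, HH. rewrite Cmod_polar; lra. }
  split; [apply EX; lra|].
  assert (EQ : forall s, 0 < s < r -> RInt (fun t => fst (F (polar p r t))) 0 (2 * PI) =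
                                  RInt (fun t => fst (F (polar p s t))) 0 (2 * PI)).
  { intros s Hs.
    assert (G := goursat_rectangle (fun s t => snd (F (polar p s t)) * / s)
       (fun s t => fst (F (polar p s t))) s 0 (r - s) (2 * PI)).
    lapply G; [clear G; intro G|lra]. lapply G; [clear G; intro G|lra].
    unfold circulation in G. lapply G.
    2:{ intros s' t' Hs' _. apply polar_closed_form; [lra|]. apply HH. rewrite Cmod_polar; lra. }
    clear G. intro G.
    rewrite (RInt_ext _ (fun _ => 0)) in G.
    2:{ intros x _. unfold polar. rewrite Rplus_0_l, cos_2PI, sin_2PI, cos_0, sin_0. simpl. ring. }
    rewrite RInt_const_R in G.
    replace (s + (r - s)) with r in G by ring. rewrite Rplus_0_l in G.
    assert (M := RInt_minus (V := R_CompleteNormedModule) _ _ 0 (2 * PI)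
      (EX r ltac:(lra)) (EX s ltac:(lra))).
    assert (M' : RInt (fun t => fst (F (polar p r t)) - fst (F (polar p s t))) 0 (2 * PI) =
      RInt (fun t => fst (F (polar p r t))) 0 (2 * PI) -
      RInt (fun t => fst (F (polar p s t))) 0 (2 * PI)) by exact M.
    lra. }
  apply cond_eq. intros eps He.
  destruct (HC (eps / (4 * PI))) as (d & Hd & HF).
  { apply Rdiv_lt_0_compat; lra. }
  set (s := Rmin (r / 2) (d / 2)).
  assert (Hs0 : 0 < s) by (apply Rmin_case; lra).
  assert (Hs1 : s <= r / 2) by apply Rmin_l. assert (Hs2 : s <= d / 2) by apply Rmin_r.
  rewrite (EQ s) by lra.
  assert (Kc : RInt (fun _ => fst (F p)) 0 (2 * PI) = 2 * PI * fst (F p) :> R)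
    by (eapply eq_trans; [apply RInt_const_R|ring]).
  rewrite <- Kc.
  assert (M := RInt_minus (V := R_CompleteNormedModule) (fun t => fst (F (polar p s t)))
    (fun _ => fst (F p)) 0 (2 * PI) (EX s ltac:(lra)) (ex_RInt_const _ _ _)).
  change (minus (RInt (fun t => fst (F (polar p s t))) 0 (2 * PI)) (RInt (fun _ => fst (F p)) 0 (2 * PI)))
    with (RInt (fun t => fst (F (polar p s t))) 0 (2 * PI) - RInt (fun _ => fst (F p)) 0 (2 * PI)) in M.
  rewrite <- M. apply Rle_lt_trans with ((2 * PI - 0) * (eps / (4 * PI))).
  - apply abs_RInt_le_const; [lra| |].
    + apply (ex_RInt_minus (V := R_CompleteNormedModule)); [apply EX; lra|apply ex_RInt_const].
    + intros t _. apply Rlt_le.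
      eapply Rle_lt_trans; [exact (Cmod_fst (F (polar p s t) - F p)%C)|]. apply HF.
      rewrite Cmod_polar; lra.
  - replace ((2 * PI - 0) * (eps / (4 * PI))) with (eps / 2) by (field; lra). lra.
Qed.

Lemma list_isolated (E : list Cx) (p : Cx) :
  exists d, 0 < d /\ forall q, In q E -> q <> p -> d <= Cmod (q - p).
Proof.
  induction E as [|q E (d & Hd & H)].
  - exists 1. split; [lra|]. intros q [].
  - destruct (excluded_middle_informative (q = p)) as [->|N].
    + exists d. split; [assumption|]. intros q' [<-|Hq] Hn; [contradiction|auto].
    + exists (Rmin d (Cmod (q - p))). split.
      * apply Rmin_case; [assumption|apply Cmod_minus_pos; assumption].
      * intros q' [<-|Hq] Hn; [apply Rmin_r|].
        eapply Rle_trans; [apply Rmin_l|auto].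
Qed.

(* Adding e|z - c|^2 makes the real part strictly subharmonic, so an interior maximum contradicts the mean value property. *)
Lemma real_part_maximum_principle F c r E M :
  0 < r ->
  (forall z, Cmod (z - c) <= r -> contC F z) ->
  (forall z, Cmod (z - c) < r -> ~ In z E -> holC F z) ->
  (forall z, Cmod (z - c) = r -> fst (F z) <= M) ->
  forall z, Cmod (z - c) <= r -> fst (F z) <= M.
Proof.
  intros Hr HC HH HM z0 Hz0. apply Rnot_lt_le. intro Hlt.
  (* With this e the perturbation is at most half of the excess over M, so the maximum of [W] cannot
     lie on the boundary circle. *)
  set (e := (fst (F z0) - M) / (2 * r ^ 2)).
  assert (Hr2 : 0 < r ^ 2) by nra.
  assert (He : 0 < e) by (apply Rdiv_lt_0_compat; lra).
  assert (Her : e * r ^ 2 = (fst (F z0) - M) / 2) by (unfold e; field; lra).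
  set (W := fun z => fst (F z) + e * Cmod (z - c) ^ 2).
  destruct (continuous_attains_max W c r) as (p & Hp & Hmax); [lra| |].
  { intros z Hz eps Heps.
    assert (C1 := HC z Hz).
    assert (C2 : contC (fun w => ((w - c) * (w - c))%C) z).
    { apply contC_mult; (apply contC_minus; [apply contC_id|apply contC_const]). }
    destruct (C1 (eps / 2)) as (d1 & Hd1 & H1); [lra|].
    destruct (C2 (eps / 2 / e)) as (d2 & Hd2 & H2); [apply Rdiv_lt_0_compat; lra|].
    exists (Rmin d1 d2). split; [apply Rmin_case; assumption|]. intros w Hw.
    assert (A := Rmin_l d1 d2). assert (B := Rmin_r d1 d2).
    specialize (H1 w ltac:(lra)). specialize (H2 w ltac:(lra)).
    assert (T1 := Cmod_fst (F w - F z)%C). simpl in T1.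
    assert (T2 : Rabs (Cmod (w - c) ^ 2 - Cmod (z - c) ^ 2) <= Cmod ((w - c) * (w - c) - (z - c) * (z - c))).
    { replace (Cmod (w - c) ^ 2) with (Cmod ((w - c) * (w - c))) by (rewrite Cmod_mult; ring).
      replace (Cmod (z - c) ^ 2) with (Cmod ((z - c) * (z - c))) by (rewrite Cmod_mult; ring).
      set (x := ((w - c) * (w - c))%C). set (y := ((z - c) * (z - c))%C).
      assert (L1 := Cmod_le_plus x y). assert (L2 := Cmod_le_plus y x).
      rewrite Cmod_minus_sym in L2. apply Rabs_le. lra. }
    unfold W. replace (fst (F w) + e * Cmod (w - c) ^ 2 - (fst (F z) + e * Cmod (z - c) ^ 2))
      with ((fst (F w) + - fst (F z)) + e * (Cmod (w - c) ^ 2 - Cmod (z - c) ^ 2)) by ring.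
    eapply Rle_lt_trans; [apply Rabs_triang|]. rewrite Rabs_mult, (Rabs_right e) by lra.
    apply Rle_lt_trans with (Cmod (F w - F z) + e * Cmod ((w - c) * (w - c) - (z - c) * (z - c))).
    - apply Rplus_le_compat; [assumption|]. apply Rmult_le_compat_l; lra.
    - replace eps with (eps / 2 + e * (eps / 2 / e)) by (field; lra).
      apply Rplus_lt_compat; [assumption|]. apply Rmult_lt_compat_l; assumption. }
  assert (Hint : Cmod (p - c) < r).
  { destruct Hp as [|Hp]; [assumption|exfalso].
    specialize (Hmax z0 Hz0). unfold W in Hmax. rewrite Hp in Hmax.
    specialize (HM p Hp). assert (P := Cmod_ge_0 (z0 - c)). nra. }
  destruct (list_isolated E p) as (d & Hd & Hiso).
  (* The closed disc of radius s around p stays in the open disc and meets [E] at most in p, where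
     the mean value property only asks for continuity. *)
  set (s := Rmin (d / 2) ((r - Cmod (p - c)) / 2)).
  assert (Hs : 0 < s) by (apply Rmin_case; lra).
  assert (Hs1 : s <= d / 2) by apply Rmin_l.
  assert (Hs2 : s <= (r - Cmod (p - c)) / 2) by apply Rmin_r.
  destruct (mean_value F p s Hs) as [EX MV].
  { apply HC. assumption. }
  { intros z Hz. apply HH.
    - assert (T := Cmod_minus_triangle z p c). lra.
    - intro I. assert (z <> p).
      { intros ->. rewrite Cmod_self_minus in Hz. lra. }
      specialize (Hiso z I H). lra. }
  assert (Hpi := PI_RGT_0).
  (* [B] is the bound on Re F that W <= W(p) gives on the circle. Its cosine and sine terms
     integrate to zero, so the average of Re F falls short of Re F(p) by at least e s^2. *)
  set (B := fun t => fst (F p) - e * s ^ 2 -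
              (2 * e * s * fst (p - c)%C * cos t + 2 * e * s * snd (p - c)%C * sin t)).
  assert (IB : is_RInt B 0 (2 * PI) (2 * PI * (fst (F p) - e * s ^ 2))).
  { set (Pr := fun t => t * (fst (F p) - e * s ^ 2) -
       (2 * e * s * fst (p - c)%C * sin t - 2 * e * s * snd (p - c)%C * cos t)).
    replace (2 * PI * (fst (F p) - e * s ^ 2)) with (Pr (2 * PI) - Pr 0).
    2:{ unfold Pr. rewrite cos_2PI, sin_2PI, cos_0, sin_0. ring. }
    apply (is_RInt_derive (V := R_CompleteNormedModule) Pr B).
    - intros x _. unfold Pr, B. auto_derive; [trivial|].
      simpl. match goal with |- @eq _ ?a ?b => change (@eq R a b) end. ring.
    - intros x _. unfold B. apply (ex_derive_continuous (V := R_NormedModule)).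
      auto_derive. trivial. }
  assert (LE : RInt (fun t => fst (F (polar p s t))) 0 (2 * PI) <= RInt B 0 (2 * PI)).
  { apply RInt_le; [lra|assumption|eexists; exact IB|].
    intros t _. assert (Hin : Cmod (polar p s t - c) <= r).
    { assert (T := Cmod_minus_triangle (polar p s t) p c).
      rewrite Cmod_polar in T by lra. lra. }
    specialize (Hmax _ Hin). unfold W in Hmax.
    assert (SQ : Cmod (polar p s t - c) ^ 2 = Cmod (p - c) ^ 2 + s ^ 2 +
      2 * s * fst (p - c)%C * cos t + 2 * s * snd (p - c)%C * sin t).
    { rewrite !Cmod2_alt. unfold Re, Im, polar. simpl.
      replace (s * (s * 1)) with (s ^ 2 * ((sin t)² + (cos t)²)) by (rewrite sin2_cos2; ring).
      unfold Rsqr. ring. }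
    unfold B. rewrite SQ in Hmax. lra. }
  rewrite (is_RInt_unique _ _ _ _ IB), MV in LE.
  assert (0 < e * s ^ 2) by (apply Rmult_lt_0_compat; [lra|apply pow_lt; lra]). nra.
Qed.

(** Multiplying F by the unimodular constant [k] makes the value at the given point real and
    nonnegative, which reduces the modulus to the real part. [E] collects the points where F is
    known only to be continuous. *)
Theorem maximum_principle F c r E M :
  0 < r ->
  (forall z, Cmod (z - c) <= r -> contC F z) ->
  (forall z, Cmod (z - c) < r -> ~ In z E -> holC F z) ->
  (forall z, Cmod (z - c) = r -> Cmod (F z) <= M) ->
  forall z, Cmod (z - c) <= r -> Cmod (F z) <= M.
Proof.
  intros Hr HC HH HM z Hz.
  destruct (excluded_middle_informative (F z = 0%C)) as [E0|N0].
  { assert (P : 0 <= M).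
    { eapply Rle_trans; [apply Cmod_ge_0|]. apply (HM (polar c r 0)). apply Cmod_polar. lra. }
    rewrite E0, Cmod_0. assumption. }
  set (k := (Cconj (F z) / Cmod (F z))%C).
  assert (Hpos := proj1 (Cmod_gt_0 _) N0).
  assert (Hne : RtoC (Cmod (F z)) <> 0%C).
  { intro A. apply RtoC_inj in A. lra. }
  assert (Hk : Cmod k = 1).
  { unfold k. rewrite Cmod_div by assumption. rewrite Cmod_conj, Cmod_R, Rabs_right by lra.
    field. lra. }
  assert (Hkz : (k * F z)%C = RtoC (Cmod (F z))).
  { unfold k. replace (Cconj (F z) / Cmod (F z) * F z)%C
      with ((F z * Cconj (F z)) / Cmod (F z))%C by (field; assumption).
    rewrite <- Cmod2_conj. rewrite RtoC_pow. field. assumption. }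
  replace (Cmod (F z)) with (fst (k * F z)%C) by (rewrite Hkz; reflexivity).
  revert z Hz N0 k Hpos Hne Hk Hkz. intros z Hz _ k _ _ Hk _.
  apply (real_part_maximum_principle (fun w => (k * F w)%C) c r E M); try assumption.
  - intros w Hw. apply contC_mult; [apply contC_const|auto].
  - intros w Hw Hn. apply holC_mult; [apply holC_const|auto].
  - intros w Hw. eapply Rle_trans; [apply Rle_abs|]. eapply Rle_trans; [apply Cmod_fst|].
    rewrite Cmod_mult, Hk, Rmult_1_l. auto.
Qed.

(** * A Blaschke type estimate for asymptotic zeros *)

Lemma difference_quotient_cont F p Phi z :
  (forall w, F w - F p = Phi w * (w - p))%C -> z <> p -> contC F z -> contC Phi z.
Proof.
  intros E Hz HF.
  apply contC_ext_loc with (F := fun w => ((F w - F p) / (w - p))%C) (d := Cmod (z - p)).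
  - apply Cmod_minus_pos. assumption.
  - intros w Hw. rewrite E. field. intro A.
    assert (B : w = p) by (apply Cmod_minus_eq_0; rewrite A; apply Cmod_0).
    subst. rewrite Cmod_minus_sym in Hw. lra.
  - apply contC_mult; [apply contC_minus; [assumption|apply contC_const]|].
    apply contC_inv; [|apply Cminus_neq_0; assumption].
    apply contC_minus; [apply contC_id|apply contC_const].
Qed.

Definition vanishing (u : nat -> Cx) : Prop :=
  forall eps, 0 < eps -> exists N, forall n, (N <= n)%nat -> Cmod (u n) < eps.

(* Dividing by z - p for each asymptotic zero p near the centre gains a factor (r/2) / (3r/4) = 2/3. *)
Lemma asymptotic_zeros_bound c r : 0 < r -> forall ps, NoDup ps ->
  (forall p, In p ps -> Cmod (p - c) < r / 4) ->
  forall (G : nat -> Cx -> Cx) E M, 0 <= M ->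
  (forall p, In p ps -> ~ In p E) ->
  (forall n z, Cmod (z - c) <= r -> contC (G n) z) ->
  (forall n z, Cmod (z - c) <= r -> ~ In z E -> holC (G n) z) ->
  (forall p, In p ps -> vanishing (fun n => G n p)) ->
  (forall eps, 0 < eps -> exists N, forall n, (N <= n)%nat ->
     forall z, Cmod (z - c) = r -> Cmod (G n z) <= M + eps) ->
  forall w, Cmod (w - c) < r / 4 -> forall eps, 0 < eps ->
  exists N, forall n, (N <= n)%nat -> Cmod (G n w) <= M * (2 / 3) ^ length ps + eps.
Proof.
  intro Hr. induction ps as [|p ps IH]; intros ND Hps G E M HM HE HC HH HV HB w Hw eps Heps.
  - destruct (HB eps Heps) as [N HN]. exists N. intros n Hn. simpl. rewrite Rmult_1_r.
    apply (maximum_principle (G n) c r E (M + eps)); auto.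
    + intros z Hz. apply HH. lra.
    + lra.
  - assert (Hp : Cmod (p - c) < r / 4) by (apply Hps; left; reflexivity).
    destruct (seq_choice (fun n Phi => contC Phi p /\
       forall w, (G n w - G n p = Phi w * (w - p))%C)) as [H HQ].
    { intro n. apply HH; [lra|]. apply HE. left; reflexivity. }
    assert (Hr0 : 0 < 3 * r / 4) by lra.
    assert (Vp : vanishing (fun n => G n p)) by (apply HV; left; reflexivity).
    assert (ND1 := proj1 (proj1 (NoDup_cons_iff _ _) ND)).
    assert (ND2 := proj2 (proj1 (NoDup_cons_iff _ _) ND)).
    assert (Hq : forall n z, z <> p -> Cmod (H n z) = Cmod (G n z - G n p) / Cmod (z - p)).
    { intros n z Hz. rewrite (proj2 (HQ n)), Cmod_mult. field.
      apply Rgt_not_eq, Cmod_minus_pos. assumption. }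
    (* On the circle |z - p| > 3r/4, whence the new bound; p joins the exceptional points.
       Multiplying back by |w - p| < r/2 turns the error eps/r into eps/2, and the other half pays
       for [G n p]. *)
    destruct (IH ND2 (fun q Hq => Hps q (or_intror Hq)) H (p :: E) (M / (3 * r / 4)))
      with (w := w) (eps := eps / r) as [N1 HN1]; clear IH.
    + apply Rle_mult_inv_pos; assumption.
    + intros q Hq' [->|Hin]; [contradiction|]. apply (HE q); [right; assumption|assumption].
    + intros n z Hz. destruct (excluded_middle_informative (z = p)) as [->|Hn]; [apply HQ|].
      apply difference_quotient_cont with (G n) p; [apply HQ|assumption|auto].
    + intros n z Hz Hn. apply difference_quotient_hol with (G n) p; [apply HQ| |].
      * intros ->. apply Hn. left; reflexivity.
      * apply HH; [assumption|]. intro. apply Hn. right; assumption.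
    + intros q Hin e He. assert (Hqp : q <> p) by (intros ->; contradiction).
      assert (Pq := Cmod_minus_pos _ _ Hqp).
      assert (Hee : 0 < e * Cmod (q - p) / 2).
      { apply Rdiv_lt_0_compat; [apply Rmult_lt_0_compat; lra|lra]. }
      destruct (HV q (or_intror Hin) _ Hee) as [K1 HK1].
      destruct (Vp _ Hee) as [K2 HK2]. exists (Nat.max K1 K2). intros n Hn.
      rewrite Hq by assumption.
      specialize (HK1 n ltac:(lia)). specialize (HK2 n ltac:(lia)).
      apply Rmult_lt_reg_r with (Cmod (q - p)); [assumption|].
      unfold Rdiv. rewrite Rmult_assoc, Rinv_l by lra.
      assert (T := Cmod_minus_le (G n q) (G n p)). lra.
    + intros e He.
      assert (Hee : 0 < e * (3 * r / 4) / 2).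
      { apply Rdiv_lt_0_compat; [apply Rmult_lt_0_compat; lra|lra]. }
      destruct (HB _ Hee) as [K1 HK1]. destruct (Vp _ Hee) as [K2 HK2].
      exists (Nat.max K1 K2). intros n Hn z Hz.
      specialize (HK1 n ltac:(lia) z Hz). specialize (HK2 n ltac:(lia)).
      assert (T0 := Cmod_minus_triangle z p c).
      assert (Hzp : z <> p) by (intros ->; lra).
      rewrite Hq by assumption.
      assert (T := Cmod_minus_le (G n z) (G n p)).
      replace (M / (3 * r / 4) + e) with ((M + e * (3 * r / 4)) / (3 * r / 4)) by (field; lra).
      unfold Rdiv at 1 2. apply Rmult_le_compat.
      * apply Cmod_ge_0.
      * apply Rlt_le, Rinv_0_lt_compat. lra.
      * lra.
      * apply Rinv_le_contravar; lra.
    + assumption.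
    + apply Rdiv_lt_0_compat; assumption.
    + destruct (Vp (eps / 2)) as [N2 HN2]; [lra|].
      exists (Nat.max N1 N2). intros n Hn.
      specialize (HN1 n ltac:(lia)). specialize (HN2 n ltac:(lia)).
      assert (E1 : G n w = (G n p + H n w * (w - p))%C).
      { rewrite <- (proj2 (HQ n) w). ring. }
      assert (T0 := Cmod_minus_triangle w c p). rewrite (Cmod_minus_sym c p) in T0.
      rewrite E1. eapply Rle_trans; [apply Cmod_triangle|]. rewrite Cmod_mult.
      assert (P1 := Cmod_ge_0 (H n w)). assert (P2 := Cmod_ge_0 (w - p)).
      assert (L : Cmod (H n w) * Cmod (w - p) <=
                  (M / (3 * r / 4) * (2 / 3) ^ length ps + eps / r) * (r / 2)).
      { apply Rmult_le_compat; lra. }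
      replace ((M / (3 * r / 4) * (2 / 3) ^ length ps + eps / r) * (r / 2))
        with (M * (2 / 3) ^ length (p :: ps) + eps / 2) in L by (simpl; field; lra).
      lra.
Qed.

(** * The Riemann sphere *)

Definition S0 : Csph := Some C0.

(** The value at infinity is a placeholder; results using it first secure that the argument is
    finite. *)
Definition finite_part (p : Csph) : Cx := match p with Some z => z | None => C0 end.

Lemma sph_inv_Some z : z <> C0 -> sph_inv (Some z) = Some (/ z)%C.
Proof.
  intro H. destruct z as [x y]. unfold sph_inv. simpl.
  destruct (Req_EM_T x 0) as [->|]; [|reflexivity].
  destruct (Req_EM_T y 0) as [->|]; [|reflexivity].
  exfalso. apply H. reflexivity.
Qed.

Lemma sph_inv_0 : sph_inv S0 = None.
Proof. unfold sph_inv. simpl. destruct (Req_EM_T 0 0) as [_|N]; [reflexivity|congruence]. Qed.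

Lemma sph_inv_involutive p : sph_inv (sph_inv p) = p.
Proof.
  destruct p as [z|].
  - destruct (excluded_middle_informative (z = C0)) as [->|N].
    + change (Some C0) with S0. rewrite sph_inv_0. reflexivity.
    + assert (N' : z <> RtoC 0) by exact N.
      rewrite (sph_inv_Some z N), sph_inv_Some.
      * assert (E : (/ / z)%C = z) by (field; assumption). rewrite E. reflexivity.
      * intro A. apply C1_nz. replace (RtoC 1) with (z * / z)%C by (field; assumption).
        rewrite A. change C0 with (RtoC 0). ring.
  - apply sph_inv_0.
Qed.

Lemma sph_inv_eq_None p : sph_inv p = None -> p = S0.
Proof. intro H. rewrite <- (sph_inv_involutive p), H. reflexivity. Qed.

Lemma sph_inv_eq_0 p : sph_inv p = S0 -> p = None.
Proof. intro H. rewrite <- (sph_inv_involutive p), H. apply sph_inv_0. Qed.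

(** Stereographic projection to the unit sphere, the third coordinate being (|z|^2 - 1) / (|z|^2 +
    1). It exhibits [rho] as a Euclidean chord length. *)
Definition stereo (p : Csph) : R * R * R :=
  match p with
  | Some z => let q := 1 + (fst z ^ 2 + snd z ^ 2) in
              (2 * fst z / q, 2 * snd z / q, (q - 2) / q)
  | None => (0, 0, 1)
  end.

Definition dist3sq (a b : R * R * R) : R :=
  (fst (fst a) - fst (fst b)) ^ 2 + (snd (fst a) - snd (fst b)) ^ 2 + (snd a - snd b) ^ 2.

Lemma Cnorm_sq z : Cnorm z ^ 2 = fst z ^ 2 + snd z ^ 2.
Proof. exact (Cmod2_alt z). Qed.

Lemma rho_nonneg p q : 0 <= rho p q.
Proof.
  assert (S : forall x, 0 <= sqrt x) by apply sqrt_pos.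
  destruct p as [z|], q as [w|]; simpl; try lra;
    (apply Rdiv_le_0_compat; [try apply Rmult_le_pos; try lra; apply S|]);
    apply sqrt_lt_R0; assert (P := Cnorm_sq z) || assert (P := Cnorm_sq w);
    try assert (P' := Cnorm_sq w); simpl in *; nra.
Qed.

Lemma rho_sq p q : rho p q ^ 2 = dist3sq (stereo p) (stereo q).
Proof.
  assert (Q : forall x : Cplx, 0 < 1 + (fst x ^ 2 + snd x ^ 2)) by (intro; nra).
  destruct p as [z|], q as [w|]; unfold rho, stereo, dist3sq; cbn [fst snd].
  - rewrite !Cnorm_sq. assert (Qz := Q z). assert (Qw := Q w).
    unfold Rdiv at 1. rewrite Rpow_mult_distr, pow_inv, pow2_sqrt by nra.
    rewrite Rpow_mult_distr, Cnorm_sq. unfold Csub. cbn [fst snd]. field. lra.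
  - rewrite !Cnorm_sq. assert (Qz := Q z).
    unfold Rdiv at 1. rewrite Rpow_mult_distr, pow_inv, pow2_sqrt by nra.
    field. lra.
  - rewrite !Cnorm_sq. assert (Qw := Q w).
    unfold Rdiv at 1. rewrite Rpow_mult_distr, pow_inv, pow2_sqrt by nra.
    field. lra.
  - ring.
Qed.

Lemma rho_stereo p q : rho p q = sqrt (dist3sq (stereo p) (stereo q)).
Proof. rewrite <- rho_sq, sqrt_pow2; [reflexivity|apply rho_nonneg]. Qed.

Lemma rho_refl p : rho p p = 0.
Proof. rewrite rho_stereo. unfold dist3sq. rewrite <- sqrt_0. f_equal. ring. Qed.

Lemma rho_sym p q : rho p q = rho q p.
Proof. rewrite !rho_stereo. unfold dist3sq. f_equal. ring. Qed.

Lemma sqrt_dist3sq a b :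
  sqrt (dist3sq a b) = Cmod (Cmod (fst a - fst b)%C, snd a - snd b).
Proof.
  unfold Cmod at 1. cbn [fst snd]. rewrite Cmod2_alt. reflexivity.
Qed.

(** Minkowski's inequality in three dimensions from the complex one used twice: for the first two
    coordinates, then for their modulus paired with the third. *)
Lemma rho_triangle p q s : rho p s <= rho p q + rho q s.
Proof.
  rewrite !rho_stereo, !sqrt_dist3sq.
  set (a := stereo p). set (b := stereo q). set (c := stereo s).
  eapply Rle_trans with (Cmod (Cplus (Cmod (fst a - fst b)%C, snd a - snd b)
                                    (Cmod (fst b - fst c)%C, snd b - snd c))); [|apply Cmod_triangle].
  unfold Cmod at 1 3. cbn [fst snd Cplus]. apply sqrt_le_1_alt.
  replace (snd a - snd b + (snd b - snd c)) with (snd a - snd c) by ring.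
  apply Rplus_le_compat_r. apply pow_incr. split; [apply Cmod_ge_0|].
  apply Cmod_minus_triangle.
Qed.

(** On the sphere, z -> 1/z is the half turn (x, y, t) -> (x, -y, -t), an isometry. *)
Lemma rho_sph_inv p q : rho (sph_inv p) (sph_inv q) = rho p q.
Proof.
  assert (H : forall p, stereo (sph_inv p) =
    (fst (fst (stereo p)), - snd (fst (stereo p)), - snd (stereo p))).
  { intros [z|].
    - destruct (excluded_middle_informative (z = C0)) as [->|N].
      + change (Some C0) with S0. rewrite sph_inv_0. simpl. f_equal; [f_equal|]; field.
      + rewrite sph_inv_Some by assumption.
        assert (P : 0 < fst z ^ 2 + snd z ^ 2).
        { apply Cmod_gt_0 in N. assert (A := Cmod2_alt z). unfold Re, Im in A. nra. }
        unfold stereo, Complex.Cinv. cbn [fst snd].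
        f_equal; [f_equal|]; field; repeat split; nra.
    - simpl. f_equal; [f_equal|]; field. }
  rewrite !rho_stereo, !H. unfold dist3sq. cbn [fst snd]. f_equal. ring.
Qed.

Lemma rho_le_dist z w : rho (Some z) (Some w) <= 2 * Cmod (z - w).
Proof.
  unfold rho. change (Cnorm (Csub z w)) with (Cmod (z - w)). rewrite !Cnorm_sq.
  assert (P := Cmod_ge_0 (z - w)).
  assert (1 <= sqrt ((1 + (fst z ^ 2 + snd z ^ 2)) * (1 + (fst w ^ 2 + snd w ^ 2)))).
  { rewrite <- sqrt_1 at 1. apply sqrt_le_1_alt.
    assert (0 <= fst z ^ 2 + snd z ^ 2) by nra. assert (0 <= fst w ^ 2 + snd w ^ 2) by nra. nra. }
  apply Rle_div_l; [lra|]. nra.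
Qed.

Lemma dist_le_rho K z w : Cmod z <= K -> Cmod w <= K ->
  Cmod (z - w) <= (1 + K ^ 2) / 2 * rho (Some z) (Some w).
Proof.
  intros Hz Hw. assert (Pz := Cmod_ge_0 z). assert (Pw := Cmod_ge_0 w).
  unfold rho. change (Cnorm (Csub z w)) with (Cmod (z - w)).
  change (Cnorm z) with (Cmod z). change (Cnorm w) with (Cmod w).
  assert (P := Cmod_ge_0 (z - w)).
  set (s := sqrt ((1 + Cmod z ^ 2) * (1 + Cmod w ^ 2))).
  assert (Hs : s <= 1 + K ^ 2).
  { unfold s. rewrite <- (sqrt_pow2 (1 + K ^ 2)) by nra. apply sqrt_le_1_alt.
    replace ((1 + K ^ 2) ^ 2) with ((1 + K ^ 2) * (1 + K ^ 2)) by ring.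
    apply Rmult_le_compat; nra. }
  assert (Hs0 : 0 < s) by (apply sqrt_lt_R0; nra).
  replace ((1 + K ^ 2) / 2 * (2 * Cmod (z - w) / s)) with ((1 + K ^ 2) * Cmod (z - w) / s)
    by (field; lra).
  apply Rle_div_r; nra.
Qed.

Lemma rho_0_infinity : rho S0 None = 2.
Proof.
  unfold rho, S0. rewrite Cnorm_sq. simpl. replace (1 + (0 * (0 * 1) + 0 * (0 * 1))) with 1 by ring.
  rewrite sqrt_1. field.
Qed.

Lemma rho_near_0 p : rho p S0 < 1 -> exists z, p = Some z /\ Cmod z < 1.
Proof.
  intro H. destruct p as [z|].
  - exists z. split; [reflexivity|]. assert (Q := rho_sq (Some z) S0).
    assert (Q0 := rho_nonneg (Some z) S0).
    unfold stereo, S0, dist3sq in Q. cbn [fst snd C0] in Q.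
    assert (A := Cmod2_alt z). unfold Re, Im in A. rewrite <- A in Q.
    assert (Pz := Cmod_ge_0 z). set (m := Cmod z) in *.
    assert (E : rho (Some z) S0 ^ 2 = 4 * m ^ 2 / (1 + m ^ 2)).
    { unfold S0. rewrite Q.
      replace ((2 * fst z / (1 + m ^ 2) - 2 * 0 / (1 + (0 ^ 2 + 0 ^ 2))) ^ 2 +
         (2 * snd z / (1 + m ^ 2) - 2 * 0 / (1 + (0 ^ 2 + 0 ^ 2))) ^ 2)
        with (4 * (fst z ^ 2 + snd z ^ 2) / (1 + m ^ 2) ^ 2) by (field; nra).
      rewrite <- A. fold m. field. nra. }
    assert (rho (Some z) S0 ^ 2 < 1) by nra.
    rewrite E in H0. apply Rlt_div_l in H0; nra.
  - rewrite rho_sym, rho_0_infinity in H. lra.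
Qed.

Lemma Cminus_C0 (z : Cx) : (z - C0)%C = z.
Proof. change C0 with (RtoC 0). ring. Qed.

(** On the unit disc the factor (1 + K^2) / 2 of [dist_le_rho] equals 1, so passing from the chord
    to the modulus loses nothing. *)
Lemma rho_small_0 p : rho p S0 < 1 -> Cmod (finite_part p) <= rho p S0.
Proof.
  intro H. destruct (rho_near_0 p H) as (z & -> & Hz). simpl finite_part.
  assert (A := dist_le_rho 1 z C0 ltac:(lra)).
  rewrite Cminus_C0 in A.
  assert (B : Cmod C0 <= 1) by (change C0 with (RtoC 0); rewrite Cmod_0; lra).
  specialize (A B). change (Cmod z <= (1 + 1 ^ 2) / 2 * rho (Some z) S0) in A. lra.
Qed.

Lemma rho_away_infinity p k : 0 < k -> k <= rho p None -> exists z, p = Some z /\ Cmod z <= 2 / k.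
Proof.
  intros Hk H. destruct p as [z|]; [|simpl in H; lra].
  exists z. split; [reflexivity|]. simpl in H.
  change (Cnorm z) with (Cmod z) in H. assert (P := Cmod_ge_0 z).
  assert (L : Cmod z <= sqrt (1 + Cmod z * (Cmod z * 1))).
  { rewrite <- (sqrt_pow2 (Cmod z)) at 1 by assumption. apply sqrt_le_1_alt. simpl. lra. }
  set (s := sqrt _) in *.
  assert (Hs : 0 < s) by (apply sqrt_lt_R0; nra).
  apply Rle_div_r in H; [|assumption]. apply Rle_div_r; [assumption|]. nra.
Qed.

Lemma rho_away_0 z k : k <= rho (Some z) S0 -> k / 2 <= Cmod z.
Proof.
  intro H. assert (A := rho_le_dist z C0).
  rewrite Cminus_C0 in A. change (rho (Some z) S0 <= 2 * Cmod z) in A. lra.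
Qed.

(** * Meromorphic functions in local charts *)

Lemma holo_on_disc_holC F z0 r z :
  holo_on_disc F z0 r -> Cmod (z - z0) < r -> holC F z.
Proof.
  intros H Hz. destruct (H z Hz) as [l Hl].
  exists (fun w => if excluded_middle_informative (w = z) then l
                   else ((F w - F z) / (w - z))%C). split.
  - intros eps He. destruct (Hl eps He) as (d & Hd & Hq). exists d. split; [assumption|].
    intros w Hw. destruct (excluded_middle_informative (z = z)) as [_|N]; [|congruence].
    destruct excluded_middle_informative as [->|N].
    + rewrite Cmod_self_minus. assumption.
    + specialize (Hq (w - z)%C). change (Cnorm (w - z)%C) with (Cmod (w - z)) in Hq.
      change (Cadd z (w - z)%C) with (z + (w - z))%C in Hq.
      replace (z + (w - z))%C with w in Hq by ring.
      apply Hq; [|assumption]. apply Cminus_neq_0. assumption.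
  - intros w. destruct excluded_middle_informative as [->|N]; [ring|].
    field. apply Cminus_neq_0. assumption.
Qed.

Lemma meromorphic_sph_inv f : meromorphic f -> meromorphic (fun z => sph_inv (f z)).
Proof.
  intros H z0. destruct (H z0) as (r & Hr & F & HF & HD).
  exists r. split; [assumption|]. exists F. split; [assumption|].
  destruct HD as [HD|HD]; [right|left; assumption].
  intros z Hz. rewrite sph_inv_involutive. auto.
Qed.

Lemma meromorphic_translate f h : meromorphic f -> meromorphic (fun z => f (Cadd z h)).
Proof.
  intros H z0. destruct (H (Cadd z0 h)) as (r & Hr & F & HF & HD).
  assert (E : forall z, Csub (Cadd z h) (Cadd z0 h) = Csub z z0).
  { intro z. change ((z + h) - (z0 + h) = z - z0)%C. ring. }
  exists r. split; [assumption|]. exists (fun z => F (Cadd z h)). split.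
  - intros z Hz. destruct (HF (Cadd z h)) as [l Hl]; [rewrite E; assumption|].
    exists l. intros eps He. destruct (Hl eps He) as (d & Hd & Hq). exists d.
    split; [assumption|]. intros k Hk Hkd.
    replace (Cadd (Cadd z k) h) with (Cadd (Cadd z h) k); [auto|].
    change (z + h + k = z + k + h)%C. ring.
  - destruct HD as [HD|HD]; [left|right]; intros z Hz; apply HD; rewrite E; assumption.
Qed.

(** If the chart at z describes 1/f by F, finiteness of f at z means F(z) <> 0, and f = 1/F near z
    by continuity. *)
Lemma meromorphic_finite_holC f z : meromorphic f -> f z <> None ->
  holC (fun w => finite_part (f w)) z /\
  exists d, 0 < d /\ forall w, Cmod (w - z) < d -> f w <> None.
Proof.
  intros H Hz. destruct (H z) as (r & Hr & F & HF & HD).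
  assert (Hzz : Cmod (z - z) < r) by (rewrite Cmod_self_minus; assumption).
  assert (HFz := holo_on_disc_holC F z r z HF Hzz).
  destruct HD as [HD|HD].
  - split.
    + apply holC_ext_loc with F r; [assumption| |assumption].
      intros w Hw. rewrite HD by assumption. reflexivity.
    + exists r. split; [assumption|]. intros w Hw. rewrite HD by assumption. discriminate.
  - assert (N : F z <> RtoC 0).
    { intro A. specialize (HD z Hzz). rewrite A in HD. apply Hz.
      apply sph_inv_eq_0. exact HD. }
    destruct (contC_neq_0 F z (holC_contC _ _ HFz) N) as (d & Hd & Hn).
    assert (PF := proj1 (Cmod_gt_0 _) N).
    assert (W : forall w, Cmod (w - z) < Rmin d r -> f w = Some (/ F w)%C).
    { intros w Hw. assert (A := Rmin_l d r). assert (B := Rmin_r d r).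
      specialize (Hn w ltac:(lra)).
      rewrite <- (sph_inv_involutive (f w)), HD; [|change (Cmod (w - z) < r); lra].
      apply sph_inv_Some. change (F w <> RtoC 0). apply Cmod_gt_0. lra. }
    assert (Hm : 0 < Rmin d r) by (apply Rmin_case; assumption).
    split.
    + apply holC_ext_loc with (fun w => (/ F w)%C) (Rmin d r); [assumption| |].
      * intros w Hw. rewrite W by assumption. reflexivity.
      * apply holC_inv; assumption.
    + exists (Rmin d r). split; [assumption|]. intros w Hw. rewrite W by assumption. discriminate.
Qed.

Lemma meromorphic_rho_continuous f z eps : meromorphic f -> 0 < eps ->
  exists d, 0 < d /\ forall w, Cmod (w - z) < d -> rho (f w) (f z) < eps.
Proof.
  assert (K : forall f, meromorphic f -> f z <> None -> 0 < eps ->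
     exists d, 0 < d /\ forall w, Cmod (w - z) < d -> rho (f w) (f z) < eps).
  { clear f. intros f H Hz He. destruct (meromorphic_finite_holC f z H Hz) as (HH & d1 & Hd1 & H1).
    destruct (holC_contC _ _ HH (eps / 2)) as (d2 & Hd2 & H2); [lra|].
    exists (Rmin d1 d2). split; [apply Rmin_case; assumption|]. intros w Hw.
    assert (A := Rmin_l d1 d2). assert (B := Rmin_r d1 d2).
    specialize (H1 w ltac:(lra)). specialize (H2 w ltac:(lra)).
    destruct (f w) as [a|]; [|congruence]. destruct (f z) as [b|]; [|congruence].
    eapply Rle_lt_trans; [apply rho_le_dist|]. simpl in H2. lra. }
  intros H He. destruct (f z) as [b|] eqn:Ez.
  - destruct (K f H) as (d & Hd & Hw); [congruence|assumption|]. exists d.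
    rewrite <- Ez. auto.
  - destruct (K _ (meromorphic_sph_inv _ H)) as (d & Hd & Hw); [|assumption|].
    + rewrite Ez. discriminate.
    + exists d. split; [assumption|]. intros w Hd'. rewrite <- Ez, <- rho_sph_inv. auto.
Qed.

(** * Limits of translates *)

(** Stands in for locally uniform convergence of the translates, without naming a limit function. *)
Definition locally_cauchy (f : Cx -> Csph) (h : nat -> Cx) : Prop :=
  forall r eps, 0 < eps -> exists N, forall m n, (N <= m)%nat -> (N <= n)%nat ->
    forall z, Cmod z <= r -> rho (f (z + h m)%C) (f (z + h n)%C) < eps.

Definition unif_cont (f : Cx -> Csph) : Prop :=
  forall eps, 0 < eps -> exists d, 0 < d /\
    forall z w : Cx, Cmod (w - z) < d -> rho (f w) (f z) < eps.

Definition tends_at (f : Cx -> Csph) (h : nat -> Cx) (z : Cx) (q : Csph) : Prop :=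
  forall eps, 0 < eps -> exists N, forall n, (N <= n)%nat -> rho (f (z + h n)%C) q < eps.

(** A point p with [tends_at f h p S0] plays the role of a zero of the limit, so z is an
    accumulation point of such zeros. *)
Definition zeros_cluster_at (f : Cx -> Csph) (h : nat -> Cx) (z : Cx) : Prop :=
  forall d, 0 < d -> exists p : Cx, 0 < Cmod (p - z) < d /\ tends_at f h p S0.

Lemma rho_triangle3 a b c d : rho a d <= rho a b + rho b c + rho c d.
Proof. assert (A := rho_triangle a b d). assert (B := rho_triangle b c d). lra. Qed.

(** Pairs violating uniform continuity are moved to the origin by translation. Along a Cauchy
    subsequence all translates are close to one fixed translate, whose continuity at 0 rules the
    pairs out. *)
Lemma normal_unif_cont f : normal f -> unif_cont f.
Proof.
  intros [Hm Hn]. apply NNPP. intro NU.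
  apply not_all_ex_not in NU. destruct NU as [eps NU].
  apply imply_to_and in NU. destruct NU as [He NU].
  destruct (seq_choice (fun n (p : Cx * Cx) => Cmod (snd p - fst p) < / (INR n + 1) /\
      eps <= rho (f (snd p)) (f (fst p)))) as [u Hu].
  { intro n. apply NNPP. intro N. apply NU. exists (/ (INR n + 1)).
    split; [apply inv_INR_pos|]. intros z w Hzw. apply Rnot_le_lt. intro.
    apply N. exists (z, w). auto. }
  destruct (Hn (fun n => fst (u n))) as (phi & Hphi & HC).
  destruct (HC 1 (eps / 3)) as [N HN]; [lra|].
  destruct (meromorphic_rho_continuous _ (RtoC 0) (eps / 3)
     (meromorphic_translate f (fst (u (phi N))) Hm)) as (d & Hd & Hcont); [lra|].
  destruct (inv_INR_small (Rmin d 1)) as [N' HN']; [apply Rmin_case; lra|].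
  set (n := Nat.max N N'). set (k := (snd (u (phi n)) - fst (u (phi n)))%C).
  destruct (Hu (phi n)) as [H1 H2]. fold k in H1.
  assert (Hge := increasing_seq_ge _ Hphi n).
  specialize (HN' (phi n) ltac:(unfold n in *; lia)).
  assert (A := Rmin_l d 1). assert (B := Rmin_r d 1).
  assert (T := rho_triangle3 (f (k + fst (u (phi n)))%C) (f (k + fst (u (phi N)))%C)
    (f (0 + fst (u (phi N)))%C) (f (0 + fst (u (phi n)))%C)).
  assert (T1 : rho (f (k + fst (u (phi n)))%C) (f (k + fst (u (phi N)))%C) < eps / 3).
  { apply (HN n N); [unfold n; lia|lia|]. change (Cmod k <= 1). lra. }
  assert (T2 : rho (f (k + fst (u (phi N)))%C) (f (0 + fst (u (phi N)))%C) < eps / 3).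
  { apply (Hcont k). replace (k - 0)%C with k by ring. lra. }
  assert (T3 : rho (f (0 + fst (u (phi N)))%C) (f (0 + fst (u (phi n)))%C) < eps / 3).
  { apply (HN N n); [lia|unfold n; lia|]. change (Cmod (RtoC 0) <= 1). rewrite Cmod_0. lra. }
  replace (k + fst (u (phi n)))%C with (snd (u (phi n))) in T, T1 by (unfold k; ring).
  replace (0 + fst (u (phi n)))%C with (fst (u (phi n))) in T, T3 by ring. lra.
Qed.

Lemma cluster_zero_list f h c r : 0 < r -> zeros_cluster_at f h c -> forall K : nat,
  exists ps, length ps = K /\ NoDup ps /\
    forall p : Cx, In p ps -> p <> c /\ Cmod (p - c) < r /\ tends_at f h p S0.
Proof.
  intros Hr HA K. induction K as [|K (ps & HL & ND & HP)].
  - exists nil. split; [reflexivity|]. split; [constructor|]. intros p [].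
  - destruct (list_isolated ps c) as (d & Hd & Hiso).
    destruct (HA (Rmin d r)) as (p & Hp & HT); [apply Rmin_case; assumption|].
    assert (A := Rmin_l d r). assert (B := Rmin_r d r).
    exists (p :: ps). split; [simpl; congruence|]. split.
    + constructor; [|assumption]. intro Hin. destruct (HP p Hin) as (Hne & _).
      specialize (Hiso p Hin Hne). lra.
    + intros q [<-|Hin]; [|auto]. split; [|split; [lra|assumption]].
      intros ->. rewrite Cmod_self_minus in Hp. lra.
Qed.

(** On the disc of radius r around c the translates are eventually bounded by 1, and they have
    arbitrarily many asymptotic zeros near c, each contributing a factor 2/3. The radius r depends
    only on the modulus of continuity, so the spreading can be iterated. *)
Lemma cluster_spreads f h c r : meromorphic f -> 0 < r ->
  (forall z w : Cx, Cmod (w - z) <= r -> rho (f w) (f z) < 1 / 4) ->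
  zeros_cluster_at f h c ->
  forall w, Cmod (w - c) < r / 4 -> tends_at f h w S0.
Proof.
  intros Hm Hr Huc HA w Hw eps He.
  destruct (HA r Hr) as (p0 & Hp0 & HT0). destruct (HT0 (1 / 4)) as [N0 HN0]; [lra|].
  (* Three errors of 1/4: from z to c, from c to the asymptotic zero p0, and the value at p0. *)
  assert (Hfin : forall n z, (N0 <= n)%nat -> Cmod (z - c) <= r -> rho (f (z + h n)%C) S0 < 1).
  { intros n z Hn Hz. assert (T := rho_triangle3 (f (z + h n)%C) (f (c + h n)%C) (f (p0 + h n)%C) S0).
    specialize (HN0 n Hn).
    assert (T1 := Huc (c + h n)%C (z + h n)%C).
    replace (z + h n - (c + h n))%C with (z - c)%C in T1 by ring. specialize (T1 Hz).
    assert (T2 := Huc (c + h n)%C (p0 + h n)%C).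
    replace (p0 + h n - (c + h n))%C with (p0 - c)%C in T2 by ring.
    specialize (T2 ltac:(lra)). rewrite rho_sym in T2. lra. }
  (* The modulus will be at most eps/4 + eps/8, and [rho] to 0 is at most twice the modulus. *)
  destruct (pow_lt_1_zero (2 / 3)) with (y := eps / 4) as [K HK].
  { rewrite Rabs_right; lra. }
  { lra. }
  specialize (HK K (Nat.le_refl K)).
  destruct (cluster_zero_list f h c (r / 4) ltac:(lra) HA K) as (ps & HL & ND & HP).
  set (G := fun n z => finite_part (f (z + h (N0 + n)%nat)%C)).
  assert (HG : forall n z, Cmod (z - c) <= r -> holC (G n) z).
  { intros n z Hz. apply (holC_translate (fun w => finite_part (f w))).
    apply meromorphic_finite_holC; [assumption|].
    destruct (rho_near_0 _ (Hfin (N0 + n)%nat z ltac:(lia) Hz)) as (a & -> & _). discriminate. }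
  assert (HGs : forall n z, Cmod (z - c) <= r -> Cmod (G n z) <= rho (f (z + h (N0 + n)%nat)%C) S0).
  { intros n z Hz. apply rho_small_0. apply Hfin; [lia|assumption]. }
  destruct (asymptotic_zeros_bound c r Hr ps ND) with (G := G) (E := @nil Cx) (M := 1)
    (w := w) (eps := eps / 8) as [N1 HN1].
  - intros p Hp. apply HP. assumption.
  - lra.
  - auto.
  - intros n z Hz. apply holC_contC. auto.
  - auto.
  - intros p Hp e Hee. destruct (HP p Hp) as (_ & Hpc & HT). destruct (HT e Hee) as [N2 HN2].
    exists N2. intros n Hn. eapply Rle_lt_trans; [apply HGs; lra|]. apply HN2. lia.
  - intros e Hee. exists 0%nat. intros n _ z Hz. eapply Rle_trans; [apply HGs; lra|].
    assert (rho (f (z + h (N0 + n)%nat)%C) S0 < 1) by (apply Hfin; [lia|lra]). lra.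
  - assumption.
  - lra.
  - exists (N0 + N1)%nat. intros n Hn. specialize (HN1 (n - N0)%nat ltac:(lia)).
    unfold G in HN1. replace (N0 + (n - N0))%nat with n in HN1 by lia.
    rewrite HL in HN1. rewrite Rabs_right in HK by (apply Rle_ge, pow_le; lra).
    destruct (rho_near_0 (f (w + h n)%C)) as (a & Ea & _); [apply Hfin; [lia|lra]|].
    rewrite Ea in *. simpl finite_part in HN1.
    assert (L := rho_le_dist a C0). rewrite Cminus_C0 in L.
    change (rho (Some a) S0 <= 2 * Cmod a) in L. lra.
Qed.

(** If b is within r/8 of a cluster point a, the points b + t with small t > 0 lie within r/4 of a
    and are asymptotic zeros, so b is a cluster point too. Steps of length r/8 then reach the whole
    plane. *)
Lemma cluster_everywhere f h c r : meromorphic f -> 0 < r ->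
  (forall z w : Cx, Cmod (w - z) <= r -> rho (f w) (f z) < 1 / 4) ->
  zeros_cluster_at f h c -> forall w, zeros_cluster_at f h w.
Proof.
  intros Hm Hr Huc HA.
  assert (Hstep : forall a b, zeros_cluster_at f h a -> Cmod (b - a) <= r / 8 ->
                  zeros_cluster_at f h b).
  { intros a b Ha Hab d Hd. set (t := Rmin d (r / 8) / 2).
    assert (Ht : 0 < t) by (apply Rdiv_lt_0_compat; [apply Rmin_case; lra|lra]).
    assert (Ht1 : t < d) by (unfold t; assert (X := Rmin_l d (r / 8)); lra).
    assert (Ht2 : t < r / 8) by (unfold t; assert (X := Rmin_r d (r / 8)); lra).
    exists (b + t)%C.
    assert (E : Cmod (b + t - b) = t).
    { replace (b + t - b)%C with (RtoC t) by ring. rewrite Cmod_R, Rabs_right; lra. }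
    rewrite E. split; [lra|]. apply (cluster_spreads f h a r); try assumption.
    assert (T := Cmod_minus_triangle (b + t) b a). lra. }
  assert (Hk : forall k w, Cmod (w - c) <= INR k * (r / 8) -> zeros_cluster_at f h w).
  { induction k as [|k IH]; intros w Hw.
    - apply Hstep with c; [assumption|]. simpl in Hw. lra.
    - rewrite S_INR in Hw. assert (Pk := pos_INR k).
      (* v divides the segment from c to w so that k steps lead from c to v and one step from v to
         w. *)
      set (t := INR k / (INR k + 1)). set (v := (c + t * (w - c))%C).
      assert (Ht : 0 <= t) by (apply Rdiv_le_0_compat; lra).
      assert (Htk : t * (INR k + 1) = INR k) by (unfold t; field; lra).
      assert (P := Cmod_ge_0 (w - c)).
      apply Hstep with v.
      + apply IH. unfold v. replace (c + t * (w - c) - c)%C with (t * (w - c))%C by ring.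
        rewrite Cmod_mult, Cmod_R, Rabs_right by lra.
        apply Rle_trans with (t * ((INR k + 1) * (r / 8))); [apply Rmult_le_compat_l; lra|].
        rewrite <- Rmult_assoc, Htk. lra.
      + assert (Ht1 : 0 <= 1 - t).
        { replace (1 - t) with (1 / (INR k + 1)) by (unfold t; field; lra).
          apply Rdiv_le_0_compat; lra. }
        unfold v. replace (w - (c + t * (w - c)))%C with (RtoC (1 - t) * (w - c))%C.
        2:{ rewrite RtoC_minus. ring. }
        rewrite Cmod_mult, Cmod_R, Rabs_right by lra.
        apply Rle_trans with ((1 - t) * ((INR k + 1) * (r / 8))); [apply Rmult_le_compat_l; lra|].
        replace ((1 - t) * ((INR k + 1) * (r / 8)))
          with ((INR k + 1 - t * (INR k + 1)) * (r / 8)) by ring.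
        rewrite Htk. lra. }
  intro w. destruct (INR_unbounded (Cmod (w - c) / (r / 8))) as [k Hkw].
  apply (Hk k). apply Rlt_le. apply Rlt_div_l in Hkw; lra.
Qed.

(** A cluster point would make the translates tend to 0 at every point. The Cauchy property upgrades
    this to uniform convergence on discs, giving the constant limit 0 that N_1 forbids. *)
Lemma N1_zeros_isolated f h c : in_N1 f -> locally_cauchy f h -> ~ zeros_cluster_at f h c.
Proof.
  intros [Hn Hc] HL HA.
  destruct (normal_unif_cont f Hn (1 / 4)) as (d & Hd & Huc); [lra|].
  assert (Hr : 0 < d / 2) by lra.
  assert (Huc' : forall z w : Cx, Cmod (w - z) <= d / 2 -> rho (f w) (f z) < 1 / 4).
  { intros z w Hzw. apply Huc. lra. }
  assert (HT : forall w, tends_at f h w S0).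
  { intro w. apply (cluster_spreads f h w (d / 2)); try assumption; [apply Hn| |].
    - apply cluster_everywhere with c (d / 2); try assumption. apply Hn.
    - rewrite Cmod_self_minus. lra. }
  apply Hc. exists h, S0. intros r eps He.
  destruct (HL r (eps / 2)) as [N HN]; [lra|]. exists N. intros n Hnn z Hz.
  destruct (HT z (eps / 2)) as [N' HN']; [lra|].
  specialize (HN n (Nat.max N N') Hnn ltac:(lia) z Hz).
  specialize (HN' (Nat.max N N') ltac:(lia)).
  assert (T := rho_triangle (f (z + h n)%C) (f (z + h (Nat.max N N'))%C) S0).
  change (rho (f (z + h n)%C) S0 < eps). lra.
Qed.

(** Otherwise values tending to 0 occur on the circle for arbitrarily large indices; an accumulation
    point of their locations is an asymptotic zero on the circle, against isolation. Every radius
    below d is admissible, so that several such conditions can be met by one circle. *)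
Lemma N1_circle_away_from_0 f h c : in_N1 f -> locally_cauchy f h ->
  exists d, 0 < d /\ forall r, 0 < r < d -> exists k N, 0 < k /\
    forall n z, (N <= n)%nat -> Cmod (z - c) = r -> k <= rho (f (z + h n)%C) S0.
Proof.
  intros HN1 HL.
  assert (Hiso := N1_zeros_isolated f h c HN1 HL).
  apply not_all_ex_not in Hiso. destruct Hiso as [d Hiso].
  apply imply_to_and in Hiso. destruct Hiso as [Hd Hiso].
  exists d. split; [assumption|]. intros r Hr. apply NNPP. intro NE.
  destruct (seq_choice (fun j (p : nat * Cx) => (j <= fst p)%nat /\ Cmod (snd p - c) = r /\
     rho (f (snd p + h (fst p))%C) S0 < / (INR j + 1))) as [u Hu].
  { intro j. apply NNPP. intro N. apply NE. exists (/ (INR j + 1)), j.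
    split; [apply inv_INR_pos|]. intros n z Hn Hz. apply Rnot_lt_le. intro.
    apply N. exists (n, z). auto. }
  destruct (bolzano_weierstrass_disc (fun j => snd (u j)) c r) as (phi & l & Hphi & Hl & Hlim).
  { intro j. destruct (Hu j) as (_ & H & _). lra. }
  apply Hiso. exists l. split.
  - destruct (Hlim (r / 2)) as [N HN]; [lra|]. specialize (HN N (Nat.le_refl N)).
    destruct (Hu (phi N)) as (_ & H & _).
    assert (T := Cmod_minus_triangle (snd (u (phi N))) l c). lra.
  - intros eps He.
    destruct (normal_unif_cont f (proj1 HN1) (eps / 3)) as (e & Hee & Huc); [lra|].
    destruct (HL (Cmod l) (eps / 3)) as [N HN]; [lra|].
    destruct (Hlim e Hee) as [N' HN'].
    destruct (inv_INR_small (eps / 3)) as [N'' HN'']; [lra|].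
    exists N. intros n Hn.
    set (j := Nat.max N (Nat.max N' N'')).
    assert (Hge := increasing_seq_ge _ Hphi j).
    destruct (Hu (phi j)) as (H1 & _ & H3).
    specialize (HN' j ltac:(unfold j; lia)).
    specialize (HN'' (phi j) ltac:(unfold j in *; lia)).
    specialize (HN n (fst (u (phi j))) Hn ltac:(unfold j in *; lia) l ltac:(lra)).
    assert (T1 := Huc (snd (u (phi j)) + h (fst (u (phi j))))%C (l + h (fst (u (phi j))))%C).
    replace (l + h (fst (u (phi j))) - (snd (u (phi j)) + h (fst (u (phi j)))))%C
      with (l - snd (u (phi j)))%C in T1 by ring.
    rewrite Cmod_minus_sym in T1. specialize (T1 HN').
    assert (T := rho_triangle3 (f (l + h n)%C) (f (l + h (fst (u (phi j))))%C)
      (f (snd (u (phi j)) + h (fst (u (phi j))))%C) S0). lra.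
Qed.

Lemma in_N1_sph_inv f : in_N1 f -> in_N1 (fun z => sph_inv (f z)).
Proof.
  intros [[Hm Hn] Hc]. split; [split|].
  - apply meromorphic_sph_inv. assumption.
  - intro h. destruct (Hn h) as (phi & Hphi & H). exists phi. split; [assumption|].
    intros r eps He. destruct (H r eps He) as [N HN]. exists N. intros.
    rewrite rho_sph_inv. auto.
  - intros (h & c & H). apply Hc. exists h, (sph_inv c). intros r eps He.
    destruct (H r eps He) as [N HN]. exists N. intros.
    rewrite <- rho_sph_inv, sph_inv_involutive. auto.
Qed.

Lemma locally_cauchy_sph_inv f h :
  locally_cauchy f h -> locally_cauchy (fun z => sph_inv (f z)) h.
Proof.
  intros H r eps He. destruct (H r eps He) as [N HN]. exists N. intros.
  rewrite rho_sph_inv. auto.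
Qed.

Lemma N1_circle_away_from_infinity f h c : in_N1 f -> locally_cauchy f h ->
  exists d, 0 < d /\ forall r, 0 < r < d -> exists k N, 0 < k /\
    forall n z, (N <= n)%nat -> Cmod (z - c) = r -> k <= rho (f (z + h n)%C) None.
Proof.
  intros HN HL.
  destruct (N1_circle_away_from_0 _ h c (in_N1_sph_inv f HN) (locally_cauchy_sph_inv f h HL))
    as (d & Hd & H).
  exists d. split; [assumption|]. intros r Hr. destruct (H r Hr) as (k & N & Hk & HK).
  exists k, N. split; [assumption|]. intros n z Hn Hz.
  rewrite <- rho_sph_inv. exact (HK n z Hn Hz).
Qed.

(** * Comparing two meromorphic functions through their values on a circle *)

Section TwoFunctions.

Variables (c : Cx) (r : R).
Hypothesis Hr : 0 < r.

Definition pole_free (u : Cx -> Csph) : Prop := forall z, Cmod (z - c) <= r -> u z <> None.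

Lemma pole_free_close u v e : meromorphic u -> meromorphic v ->
  pole_free u -> pole_free v ->
  (forall z, Cmod (z - c) = r -> Cmod (finite_part (u z) - finite_part (v z)) <= e) ->
  forall z, Cmod (z - c) <= r -> rho (u z) (v z) <= 2 * e.
Proof.
  intros Mu Mv Pu Pv HB z Hz.
  assert (HH : forall w, Cmod (w - c) <= r ->
     holC (fun w => finite_part (u w) - finite_part (v w))%C w).
  { intros w Hw. apply (holC_minus (fun w => finite_part (u w)) (fun w => finite_part (v w)));
      apply meromorphic_finite_holC; auto. }
  assert (L : Cmod (finite_part (u z) - finite_part (v z)) <= e).
  { apply (maximum_principle (fun w => finite_part (u w) - finite_part (v w))%C c r nil e);
      try assumption.
    - intros w Hw. apply holC_contC. auto.
    - intros w Hw _. apply HH. lra. }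
  specialize (Pu z Hz). specialize (Pv z Hz).
  destruct (u z) as [a|]; [|congruence]. destruct (v z) as [b|]; [|congruence].
  eapply Rle_trans; [apply rho_le_dist|]. simpl in L. lra.
Qed.

(* u/v is close to 1 on the circle, hence on the disc, so it cannot vanish at a pole of v. *)
Lemma mixed_pole_free u v k e : meromorphic u -> meromorphic v -> 0 < k -> e < k ->
  pole_free u -> pole_free (fun z => sph_inv (v z)) ->
  (forall z, Cmod (z - c) = r -> exists a b : Cx, u z = Some a /\ v z = Some b /\
     k <= Cmod b /\ Cmod (a - b) <= e) ->
  pole_free v.
Proof.
  intros Mu Mv Hk Hek Pu Pv HB z Hz E.
  assert (Mv' := meromorphic_sph_inv v Mv).
  set (W := fun w => (finite_part (u w) * finite_part (sph_inv (v w)) - RtoC 1)%C).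
  assert (HH : forall w, Cmod (w - c) <= r -> holC W w).
  { intros w Hw. apply (holC_minus _ (fun _ => RtoC 1)); [|apply holC_const].
    apply (holC_mult (fun w => finite_part (u w)) (fun w => finite_part (sph_inv (v w)))).
    - apply meromorphic_finite_holC; auto.
    - apply (meromorphic_finite_holC (fun w => sph_inv (v w))); [assumption|]. apply Pv. assumption. }
  assert (L : Cmod (W z) <= e / k).
  { apply (maximum_principle W c r nil (e / k)); try assumption.
    - intros w Hw. apply holC_contC. auto.
    - intros w Hw _. apply HH. lra.
    - intros w Hw. destruct (HB w Hw) as (a & b & Ea & Eb & Hb & Hab).
      assert (Nb : b <> RtoC 0) by (apply Cmod_gt_0; lra).
      assert (Ei : sph_inv (v w) = Some (/ b)%C) by (rewrite Eb; exact (sph_inv_Some b Nb)).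
      unfold W. rewrite Ea, Ei. simpl finite_part.
      replace (a * / b - 1)%C with ((a - b) / b)%C by (field; assumption).
      rewrite Cmod_div by assumption. unfold Rdiv. apply Rmult_le_compat.
      + apply Cmod_ge_0.
      + apply Rlt_le, Rinv_0_lt_compat. lra.
      + assumption.
      + apply Rinv_le_contravar; lra. }
  unfold W in L. rewrite E in L. simpl finite_part in L. change C0 with (RtoC 0) in L.
  replace (finite_part (u z) * 0 - 1)%C with (- (1))%C in L by ring.
  rewrite Cmod_opp, Cmod_1 in L.
  apply Rle_div_r in L; lra.
Qed.

(** When one function is pole free and the other zero free, the latter is pole free as well, so the
    mixed cases reduce to comparing u and v directly. When both are zero free, 1/u and 1/v are
    compared: on the circle they differ by at most e/k^2. The stated bound covers both cases. *)
Lemma zero_or_pole_free_close u v k e : meromorphic u -> meromorphic v ->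
  0 < k -> 0 <= e -> e < k ->
  (pole_free u \/ pole_free (fun z => sph_inv (u z))) ->
  (pole_free v \/ pole_free (fun z => sph_inv (v z))) ->
  (forall z, Cmod (z - c) = r -> exists a b : Cx, u z = Some a /\ v z = Some b /\
     k <= Cmod a /\ k <= Cmod b /\ Cmod (a - b) <= e) ->
  forall z, Cmod (z - c) <= r -> rho (u z) (v z) <= 2 * (e + e / (k * k)).
Proof.
  intros Mu Mv Hk He Hek Du Dv HB.
  assert (Hkk : 0 < k * k) by (apply Rmult_lt_0_compat; assumption).
  assert (Hq : 0 <= e / (k * k)) by (apply Rdiv_le_0_compat; lra).
  assert (PP : pole_free u -> pole_free v ->
     forall z, Cmod (z - c) <= r -> rho (u z) (v z) <= 2 * (e + e / (k * k))).
  { intros Pu Pv z Hz. apply Rle_trans with (2 * e); [|lra].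
    apply pole_free_close; try assumption.
    intros w Hw. destruct (HB w Hw) as (a & b & -> & -> & _ & _ & H). exact H. }
  destruct Du as [Pu|Zu], Dv as [Pv|Zv].
  - auto.
  - apply PP; [assumption|]. apply (mixed_pole_free u v k e); try assumption.
    intros z Hz. destruct (HB z Hz) as (a & b & ? & ? & ? & ? & ?). exists a, b. auto.
  - apply PP; [|assumption]. apply (mixed_pole_free v u k e); try assumption.
    intros z Hz. destruct (HB z Hz) as (a & b & ? & ? & ? & ? & H). exists b, a.
    rewrite Cmod_minus_sym in H. auto.
  - intros z Hz. rewrite <- rho_sph_inv. apply Rle_trans with (2 * (e / (k * k))); [|lra].
    apply (pole_free_close (fun z => sph_inv (u z)) (fun z => sph_inv (v z))); try assumption;
      try (apply meromorphic_sph_inv; assumption).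
    intros w Hw. destruct (HB w Hw) as (a & b & Ea & Eb & Ha & Hb & H).
    assert (Na : a <> RtoC 0) by (apply Cmod_gt_0; lra).
    assert (Nb : b <> RtoC 0) by (apply Cmod_gt_0; lra).
    assert (Ia : sph_inv (u w) = Some (/ a)%C) by (rewrite Ea; exact (sph_inv_Some a Na)).
    assert (Ib : sph_inv (v w) = Some (/ b)%C) by (rewrite Eb; exact (sph_inv_Some b Nb)).
    rewrite Ia, Ib. simpl finite_part.
    replace (/ a - / b)%C with ((b - a) / (a * b))%C by (field; auto).
    rewrite Cmod_div, Cmod_mult, Cmod_minus_sym by (apply Cmult_neq_0; assumption).
    unfold Rdiv. apply Rmult_le_compat.
    + apply Cmod_ge_0.
    + apply Rlt_le, Rinv_0_lt_compat. nra.
    + assumption.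
    + apply Rinv_le_contravar; nra.
Qed.

End TwoFunctions.

(** * Products *)

(** Compactness of closed discs: points where the Cauchy condition fails for ever larger indices
    accumulate somewhere, and the local hypothesis there is violated. *)
Lemma locally_cauchy_of_local g h :
  (forall c : Cx, exists r, 0 < r /\ forall eps, 0 < eps -> exists N, forall m n,
     (N <= m)%nat -> (N <= n)%nat -> forall z, Cmod (z - c) <= r ->
     rho (g (z + h m)%C) (g (z + h n)%C) < eps) ->
  locally_cauchy g h.
Proof.
  intros H R eps He. apply NNPP. intro NE.
  destruct (seq_choice (fun j (p : nat * nat * Cx) =>
     (j <= fst (fst p))%nat /\ (j <= snd (fst p))%nat /\ Cmod (snd p) <= R /\
     eps <= rho (g (snd p + h (fst (fst p)))%C) (g (snd p + h (snd (fst p)))%C))) as [u Hu].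
  { intro j. apply NNPP. intro N. apply NE. exists j. intros m n Hm Hn z Hz.
    apply Rnot_le_lt. intro. apply N. exists (m, n, z). auto. }
  destruct (bolzano_weierstrass_C (fun j => snd (u j)) R) as (phi & l & Hphi & Hlim).
  { intro j. apply Hu. }
  destruct (H l) as (r & Hr & HL). destruct (HL eps He) as [N HN].
  destruct (Hlim r Hr) as [N' HN'].
  set (j := Nat.max N N'). assert (Hge := increasing_seq_ge _ Hphi j).
  destruct (Hu (phi j)) as (H1 & H2 & _ & H4).
  specialize (HN' j ltac:(unfold j; lia)).
  specialize (HN _ _ (Nat.le_trans _ _ _ (Nat.le_trans _ _ _ (Nat.le_max_l N N') Hge) H1)
                     (Nat.le_trans _ _ _ (Nat.le_trans _ _ _ (Nat.le_max_l N N') Hge) H2)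
                     (snd (u (phi j))) (Rlt_le _ _ HN')).
  lra.
Qed.

Lemma product_close (a b a' b' : Cx) K e :
  Cmod b <= K -> Cmod a' <= K -> Cmod (a - a') <= e -> Cmod (b - b') <= e ->
  Cmod (a * b - a' * b') <= 2 * K * e.
Proof.
  intros Hb Ha' Haa Hbb.
  replace (a * b - a' * b')%C with ((a - a') * b + a' * (b - b'))%C by ring.
  eapply Rle_trans; [apply Cmod_triangle|]. rewrite !Cmod_mult.
  assert (P1 := Cmod_ge_0 (a - a')). assert (P2 := Cmod_ge_0 b).
  assert (P3 := Cmod_ge_0 a'). assert (P4 := Cmod_ge_0 (b - b')).
  nra.
Qed.

Definition separated_divisor (g : Cx -> Csph) (d : R) : Prop :=
  forall a b, g a = S0 -> g b = None -> d <= Cmod (a - b).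

Lemma min5 x1 x2 x3 x4 x5 : 0 < x1 -> 0 < x2 -> 0 < x3 -> 0 < x4 -> 0 < x5 ->
  exists y, 0 < y /\ y < x1 /\ y < x2 /\ y < x3 /\ y < x4 /\ y < x5.
Proof.
  intros.
  exists (Rmin x1 (Rmin x2 (Rmin x3 (Rmin x4 x5))) / 2).
  assert (0 < Rmin x1 (Rmin x2 (Rmin x3 (Rmin x4 x5)))) by (repeat apply Rmin_case; assumption).
  assert (A1 := Rmin_l x1 (Rmin x2 (Rmin x3 (Rmin x4 x5)))).
  assert (A2 := Rmin_r x1 (Rmin x2 (Rmin x3 (Rmin x4 x5)))).
  assert (A3 := Rmin_l x2 (Rmin x3 (Rmin x4 x5))).
  assert (A4 := Rmin_r x2 (Rmin x3 (Rmin x4 x5))).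
  assert (A5 := Rmin_l x3 (Rmin x4 x5)). assert (A6 := Rmin_r x3 (Rmin x4 x5)).
  assert (A7 := Rmin_l x4 x5). assert (A8 := Rmin_r x4 x5).
  repeat split; lra.
Qed.

(* On a suitable circle both factors stay away from 0 and infinity, so the product converges there;
   the separated divisor lets the maximum principle carry the convergence inside. *)
Lemma product_locally_cauchy f1 f2 g h d :
  is_product f1 f2 g -> in_N1 f1 -> in_N1 f2 -> 0 < d -> separated_divisor g d ->
  locally_cauchy f1 h -> locally_cauchy f2 h -> locally_cauchy g h.
Proof.
  intros [Mg Hprod] H1 H2 Hd Hsep L1 L2. apply locally_cauchy_of_local. intro c.
  destruct (N1_circle_away_from_0 f1 h c H1 L1) as (d1 & Hd1 & Z1).
  destruct (N1_circle_away_from_0 f2 h c H2 L2) as (d2 & Hd2 & Z2).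
  destruct (N1_circle_away_from_infinity f1 h c H1 L1) as (d3 & Hd3 & P1).
  destruct (N1_circle_away_from_infinity f2 h c H2 L2) as (d4 & Hd4 & P2).
  (* Since r < d/2, two points of the disc are less than d apart, so no translate of g has both a
     zero and a pole in it. *)
  destruct (min5 d1 d2 d3 d4 (d / 2)) as (r & Hr & R1 & R2 & R3 & R4 & R5); try lra.
  destruct (Z1 r ltac:(lra)) as (k1 & N1 & K1 & HZ1).
  destruct (Z2 r ltac:(lra)) as (k2 & N2 & K2 & HZ2).
  destruct (P1 r ltac:(lra)) as (k3 & N3 & K3 & HP1).
  destruct (P2 r ltac:(lra)) as (k4 & N4 & K4 & HP2).
  destruct (min5 k1 k2 k3 k4 1) as (k & Hk & Q1 & Q2 & Q3 & Q4 & _); try lra.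
  clear Z1 Z2 P1 P2.
  exists r. split; [assumption|]. intros eps He.
  (* Spherical distance at least k from 0 forces modulus at least k/2, so [k'] bounds |f1 f2| from
     below on the circle. *)
  set (k' := k / 2 * (k / 2)). assert (Hk' : 0 < k') by (unfold k'; nra).
  assert (Hkk : 0 < k' * k') by nra.
  set (q := 1 + / (k' * k')).
  assert (Hq : 0 < q) by (assert (X := Rinv_0_lt_compat _ Hkk); unfold q; lra).
  (* The first term keeps the error below the lower bound [k'], as the mixed comparison demands; the
     second makes the final bound 2 eta q at most eps/2. *)
  set (eta := Rmin (k' / 2) (eps / (4 * q))).
  assert (Hee : 0 < eta) by (apply Rmin_case; [lra|apply Rdiv_lt_0_compat; lra]).
  assert (He1 : eta <= k' / 2) by apply Rmin_l.
  assert (He2 : eta <= eps / (4 * q)) by apply Rmin_r.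
  assert (He3 : 2 * (eta + eta / (k' * k')) < eps).
  { replace (eta + eta / (k' * k')) with (eta * q) by (unfold q; field; lra).
    assert (eta * q <= eps / (4 * q) * q) by (apply Rmult_le_compat_r; lra).
    replace (eps / (4 * q) * q) with (eps / 4) in H by (field; lra). lra. }
  set (K := 2 / k). assert (HK : 0 < K) by (apply Rdiv_lt_0_compat; lra).
  set (s := (1 + K ^ 2) / 2). assert (Hs : 0 < s) by (unfold s; nra).
  (* [s] converts spherical into Euclidean distance for moduli up to K, and multiplying two factors
     bounded by K costs 2K. *)
  set (e := eta / (2 * K * s)).
  assert (Hpos : 0 < 2 * K * s) by (apply Rmult_lt_0_compat; lra).
  assert (Hepos : 0 < e) by (apply Rdiv_lt_0_compat; assumption).
  destruct (L1 (Cmod c + r) e Hepos) as [N5 HL1].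
  destruct (L2 (Cmod c + r) e Hepos) as [N6 HL2].
  exists (Nat.max (Nat.max N1 N2) (Nat.max (Nat.max N3 N4) (Nat.max N5 N6))).
  intros m n Hm Hn z Hz.
  assert (Hcirc : forall j w, (Nat.max (Nat.max N1 N2) (Nat.max N3 N4) <= j)%nat ->
    Cmod (w - c) = r -> exists a b : Cx,
      f1 (w + h j)%C = Some a /\ f2 (w + h j)%C = Some b /\
      k / 2 <= Cmod a <= K /\ k / 2 <= Cmod b <= K).
  { intros j w Hj Hw.
    destruct (rho_away_infinity (f1 (w + h j)%C) k Hk) as (a & Ea & Ha).
    { specialize (HP1 j w ltac:(lia) Hw). lra. }
    destruct (rho_away_infinity (f2 (w + h j)%C) k Hk) as (b & Eb & Hb).
    { specialize (HP2 j w ltac:(lia) Hw). lra. }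
    exists a, b. split; [assumption|]. split; [assumption|].
    specialize (HZ1 j w ltac:(lia) Hw). specialize (HZ2 j w ltac:(lia) Hw).
    rewrite Ea in HZ1. rewrite Eb in HZ2.
    assert (A := rho_away_0 a k ltac:(lra)). assert (B := rho_away_0 b k ltac:(lra)).
    split; split; assumption. }
  assert (Hfree : forall j, pole_free c r (fun w => g (w + h j)%C) \/
                            pole_free c r (fun w => sph_inv (g (w + h j)%C))).
  { intro j. destruct (classic (pole_free c r (fun w => g (w + h j)%C))) as [|N]; [left; assumption|right].
    intros w Hw Ew. apply sph_inv_eq_None in Ew. apply N. intros w' Hw' Ew'.
    specialize (Hsep _ _ Ew Ew'). replace (w + h j - (w' + h j))%C with (w - w')%C in Hsep by ring.
    assert (T := Cmod_minus_triangle w c w'). rewrite (Cmod_minus_sym c w') in T. lra. }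
  eapply Rle_lt_trans; [|exact He3].
  apply (zero_or_pole_free_close c r Hr (fun w => g (w + h m)%C) (fun w => g (w + h n)%C) k' eta);
    try assumption; try lra.
  - apply (meromorphic_translate g (h m)). assumption.
  - apply (meromorphic_translate g (h n)). assumption.
  - apply Hfree.
  - apply Hfree.
  - intros w Hw.
    destruct (Hcirc m w ltac:(lia) Hw) as (a & b & Ea & Eb & Ha & Hb).
    destruct (Hcirc n w ltac:(lia) Hw) as (a' & b' & Ea' & Eb' & Ha' & Hb').
    assert (Hwc : Cmod w <= Cmod c + r) by (assert (T := Cmod_le_plus w c); lra).
    specialize (HL1 m n ltac:(lia) ltac:(lia) w Hwc).
    specialize (HL2 m n ltac:(lia) ltac:(lia) w Hwc).
    rewrite Ea, Ea' in HL1. rewrite Eb, Eb' in HL2.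
    exists (a * b)%C, (a' * b')%C.
    split; [exact (Hprod _ _ _ Ea Eb)|]. split; [exact (Hprod _ _ _ Ea' Eb')|].
    rewrite !Cmod_mult.
    split; [unfold k'; apply Rmult_le_compat; lra|].
    split; [unfold k'; apply Rmult_le_compat; lra|].
    replace eta with (2 * K * (s * e)) by (unfold e; field; lra).
    assert (A := dist_le_rho K a a' ltac:(lra) ltac:(lra)). fold s in A.
    assert (B := dist_le_rho K b b' ltac:(lra) ltac:(lra)). fold s in B.
    apply product_close; try lra.
    + eapply Rle_trans; [exact A|]. apply Rmult_le_compat_l; lra.
    + eapply Rle_trans; [exact B|]. apply Rmult_le_compat_l; lra.
Qed.

(** * Necessity of the divisor condition, and the criterion in N_1 *)

(** A Schwarz lemma: the difference quotient at c is at most 2K/r on the circle, and the maximum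
    principle, with c as exceptional point, carries the bound inside. *)
Lemma hol_oscillation F c r K : 0 < r ->
  (forall z, Cmod (z - c) <= r -> holC F z) ->
  (forall z, Cmod (z - c) <= r -> Cmod (F z) <= K) ->
  forall z, Cmod (z - c) <= r -> Cmod (F z - F c) <= 2 * K / r * Cmod (z - c).
Proof.
  intros Hr HH HK z Hz.
  assert (Hcc : Cmod (c - c) <= r) by (rewrite Cmod_self_minus; lra).
  destruct (HH c Hcc) as (P & HP & E). rewrite E, Cmod_mult.
  apply Rmult_le_compat_r; [apply Cmod_ge_0|].
  apply (maximum_principle P c r (c :: nil)); try assumption.
  - intros w Hw. destruct (excluded_middle_informative (w = c)) as [->|Hn]; [assumption|].
    apply difference_quotient_cont with F c; [assumption|assumption|]. apply holC_contC. auto.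
  - intros w Hw Hn. apply difference_quotient_hol with F c; [assumption| |apply HH; lra].
    intros ->. apply Hn. left; reflexivity.
  - intros w Hw. assert (Hw' : Cmod (w - c) <= r) by lra.
    assert (A := HK w Hw'). assert (B := HK c Hcc).
    assert (T := Cmod_minus_le (F w) (F c)). rewrite E, Cmod_mult, Hw in T.
    apply Rle_div_r; [assumption|]. lra.
Qed.

Lemma N1_poles_relatively_dense f : in_N1 f ->
  exists R0, forall w : Cx, exists b : Cx, Cmod (b - w) < R0 /\ f b = None.
Proof.
  intros HN1. assert (Mf := proj1 (proj1 HN1)). apply NNPP. intro NE.
  destruct (seq_choice (fun n (w : Cx) => forall b, Cmod (b - w) < INR n -> f b <> None)) as [w Hw].
  { intro n. apply NNPP. intro N. apply NE. exists (INR n). intro w. apply NNPP. intro N'.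
    apply N. exists w. intros b Hb Eb. apply N'. exists b. auto. }
  (* The first case supplies points y with |f(y)| > k and, because y stays in the half disc and n/2
     >= k + 1, no pole within k + 1 of y. *)
  destruct (classic (forall k, exists n (y : Cx), INR k + 1 <= INR n / 2 /\
     Cmod (y - w n) <= INR n / 2 /\ INR k < Cmod (finite_part (f y)))) as [HA|HB].
  - destruct (seq_choice (fun k (y : Cx) => INR k < Cmod (finite_part (f y)) /\
      forall b, Cmod (b - y) < INR k + 1 -> f b <> None)) as [y Hy].
    { intro k. destruct (HA k) as (n & y & Hn & Hyw & Hk). exists y. split; [assumption|].
      intros b Hb. apply (Hw n). assert (T := Cmod_minus_triangle b y (w n)). lra. }
    destruct (proj2 (proj1 HN1) y) as (phi & Hphi & HC).
    destruct (N1_circle_away_from_infinity f (fun n => y (phi n)) 0%C HN1 HC) as (d & Hd & Hcirc).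
    (* Being smaller than 1, r keeps the disc inside the pole free discs around the points y. The
       maximum principle then bounds f(y) by 2/k, uniformly in the index. *)
    set (r := Rmin d 1 / 2).
    assert (Hr0 : 0 < Rmin d 1) by (apply Rmin_case; lra).
    assert (A1 := Rmin_l d 1). assert (A2 := Rmin_r d 1).
    assert (Hr : 0 < r) by (unfold r; lra).
    destruct (Hcirc r ltac:(unfold r; lra)) as (k & N & Hk & HN).
    destruct (INR_unbounded (2 / k)) as [N' HN'].
    set (n := Nat.max N N'). assert (Hge := increasing_seq_ge _ Hphi n).
    destruct (Hy (phi n)) as [H1 H2].
    assert (HP : INR N' <= INR (phi n)) by (apply le_INR; unfold n in *; lia).
    assert (HP0 := pos_INR (phi n)).
    assert (L : Cmod (finite_part (f (0 + y (phi n))%C)) <= 2 / k).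
    { apply (maximum_principle (fun z => finite_part (f (z + y (phi n))%C)) 0%C r nil);
        try assumption.
      - intros z Hz. apply holC_contC. apply (holC_translate (fun z => finite_part (f z))).
        apply meromorphic_finite_holC; [assumption|]. apply H2.
        replace (z + y (phi n) - y (phi n))%C with (z - 0)%C by ring. unfold r in Hz. lra.
      - intros z Hz _. apply (holC_translate (fun z => finite_part (f z))).
        apply meromorphic_finite_holC; [assumption|]. apply H2.
        replace (z + y (phi n) - y (phi n))%C with (z - 0)%C by ring. unfold r in Hz. lra.
      - intros z Hz. specialize (HN n z ltac:(unfold n; lia) Hz).
        destruct (rho_away_infinity _ k Hk HN) as (a & Ea & Ha). rewrite Ea. exact Ha.
      - rewrite Cmod_self_minus. lra. }
    replace (0 + y (phi n))%C with (y (phi n)) in L by ring. lra.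
  - apply not_all_ex_not in HB. destruct HB as [k HB].
    assert (Hbd : forall n y, INR k + 1 <= INR n / 2 -> Cmod (y - w n) <= INR n / 2 ->
              Cmod (finite_part (f y)) <= INR k).
    { intros n y Hn Hy. apply Rnot_lt_le. intro. apply HB. exists n, y. auto. }
    assert (Pk := pos_INR k).
    set (n0 := (2 * (k + 1))%nat).
    assert (Hn0 : forall n, INR k + 1 <= INR (n0 + n) / 2).
    { intro n. unfold n0. rewrite plus_INR, mult_INR, plus_INR. simpl (INR 2). simpl (INR 1).
      assert (P := pos_INR n). lra. }
    destruct (bolzano_weierstrass_C (fun n => finite_part (f (w (n0 + n)%nat))) (INR k))
      as (phi & l & Hphi & Hlim).
    { intro n. apply (Hbd (n0 + n)%nat); [apply Hn0|]. rewrite Cmod_self_minus.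
      specialize (Hn0 n). lra. }
    apply (proj2 HN1). exists (fun n => w (n0 + phi n)%nat), (Some l). intros r eps He.
    destruct (Hlim (eps / 4)) as [N HN]; [lra|].
    set (B := Rmax 0 r). assert (HB0 : 0 <= B) by apply Rmax_l. assert (HBr : r <= B) by apply Rmax_r.
    (* The summand 2B puts |z| <= B inside the half disc; the other makes the Schwarz bound 4 k B /
       j at most eps/4. *)
    destruct (INR_unbounded (2 * B + 16 * (INR k + 1) * B / eps)) as [N' HN'].
    exists (Nat.max N N'). intros n Hn z Hz. change (Cmod z <= r) in Hz.
    change (rho (f (z + w (n0 + phi n)%nat)%C) (Some l) < eps).
    set (j := (n0 + phi n)%nat). assert (Hge := increasing_seq_ge _ Hphi n).
    specialize (HN n ltac:(lia)). fold j in HN.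
    assert (Hj := Hn0 (phi n)). fold j in Hj.
    assert (HjN : INR N' <= INR j) by (apply le_INR; unfold j; lia).
    assert (Pj : 0 < INR j / 2) by lra.
    assert (Hnp : forall u, Cmod (u - w j) <= INR j / 2 -> f u <> None).
    { intros u Hu. apply (Hw j). lra. }
    assert (Eq : Cmod (z + w j - w j) = Cmod z) by (f_equal; ring).
    assert (Hq : 0 <= 16 * (INR k + 1) * B / eps).
    { apply Rdiv_le_0_compat; [|assumption]. apply Rmult_le_pos; lra. }
    assert (Hzj : Cmod (z + w j - w j) <= INR j / 2) by (rewrite Eq; lra).
    assert (L := hol_oscillation (fun u => finite_part (f u)) (w j) (INR j / 2) (INR k) Pj
      (fun u Hu => proj1 (meromorphic_finite_holC f u Mf (Hnp u Hu)))
      (fun u Hu => Hbd j u Hj Hu) _ Hzj).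
    rewrite Eq in L.
    assert (L2 : 2 * INR k / (INR j / 2) * Cmod z <= eps / 4).
    { apply Rle_trans with (2 * (INR k + 1) / (INR j / 2) * B).
      - apply Rmult_le_compat; [|apply Cmod_ge_0| |lra].
        + apply Rdiv_le_0_compat; lra.
        + apply Rmult_le_compat_r; [apply Rlt_le, Rinv_0_lt_compat; assumption|lra].
      - replace (2 * (INR k + 1) / (INR j / 2) * B)
          with ((16 * (INR k + 1) * B / eps) * (eps / 4) / INR j) by (field; lra).
        apply Rle_div_l; [lra|]. rewrite Rmult_comm. apply Rmult_le_compat_l; lra. }
    specialize (Hnp _ Hzj).
    destruct (f (z + w j)%C) as [a|]; [|congruence].
    eapply Rle_lt_trans; [apply rho_le_dist|].
    assert (T := Cmod_minus_triangle a (finite_part (f (w j))) l). simpl finite_part in L. lra.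
Qed.

(** Zeros and poles are separated because 0 and infinity are at spherical distance 2 and g is
    uniformly continuous. Relative density of the zeros is that of the poles of 1/g. *)
Lemma N1_divisor_cond g : in_N1 g -> divisor_cond g.
Proof.
  intro H. split.
  - destruct (normal_unif_cont g (proj1 H) 2) as (d & Hd & Hu); [lra|].
    exists d. split; [assumption|]. intros a b Ha Hb. apply Rnot_lt_le. intro L.
    specialize (Hu b a L). rewrite Ha, Hb in Hu. change (rho S0 None < 2) in Hu.
    rewrite rho_0_infinity in Hu. lra.
  - destruct (N1_poles_relatively_dense g H) as [R1 H1].
    destruct (N1_poles_relatively_dense _ (in_N1_sph_inv g H)) as [R2 H2].
    exists (Rmax R1 R2). intro w. split.
    + destruct (H2 w) as (a & Ha & Ea). exists a. split.
      * eapply Rlt_le_trans; [exact Ha|apply Rmax_r].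
      * apply sph_inv_eq_None. exact Ea.
    + destruct (H1 w) as (b & Hb & Eb). exists b. split; [|assumption].
      eapply Rlt_le_trans; [exact Hb|apply Rmax_l].
Qed.

Lemma Cadd_Csub (a b : Cx) : Cadd (Csub a b) b = a.
Proof. change (@eq Cx (a - b + b)%C a). ring. Qed.

(** A disc of radius [R0] contains a zero and a pole, so a constant limit would be within 1 of both
    0 and infinity, whose distance is 2. *)
Lemma divisor_cond_no_constant_limit g : divisor_cond g -> ~ has_constant_translate_limit g.
Proof.
  intros [_ [R0 H]] (h & c & HC). destruct (HC R0 1) as [N HN]; [lra|].
  specialize (HN N (Nat.le_refl N)).
  destruct (H (h N)) as [(a & Ha & Ea) (b & Hb & Eb)].
  assert (A := HN (Csub a (h N)) (Rlt_le _ _ Ha)).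
  assert (B := HN (Csub b (h N)) (Rlt_le _ _ Hb)).
  rewrite Cadd_Csub in A, B.
  rewrite Ea in A. rewrite Eb, rho_sym in B.
  assert (T := rho_triangle S0 c None). rewrite rho_0_infinity in T.
  change (rho S0 c < 1) in A. lra.
Qed.

Lemma common_subsequence f1 f2 : normal f1 -> normal f2 -> forall h,
  exists phi, increasing_seq phi /\
    locally_cauchy f1 (fun n => h (phi n)) /\ locally_cauchy f2 (fun n => h (phi n)).
Proof.
  intros [_ H1] [_ H2] h. destruct (H1 h) as (phi & Hphi & C1).
  destruct (H2 (fun n => h (phi n))) as (psi & Hpsi & C2).
  exists (fun n => phi (psi n)). split; [apply increasing_seq_comp; assumption|]. split.
  - intros r eps He. destruct (C1 r eps He) as [N HN]. exists N. intros m n Hm Hn z Hz.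
    apply HN; [| |assumption].
    + assert (X := increasing_seq_ge _ Hpsi m). lia.
    + assert (X := increasing_seq_ge _ Hpsi n). lia.
  - exact C2.
Qed.

Lemma product_in_N1 f1 f2 g : is_product f1 f2 g -> in_N1 f1 -> in_N1 f2 ->
  divisor_cond g -> in_N1 g.
Proof.
  intros HP H1 H2 HD. split; [split|].
  - apply HP.
  - intro h. destruct (common_subsequence f1 f2 (proj1 H1) (proj1 H2) h) as (phi & Hphi & C1 & C2).
    exists phi. split; [assumption|].
    destruct HD as [(d & Hd & Hsep) _].
    exact (product_locally_cauchy f1 f2 g _ d HP H1 H2 Hd Hsep C1 C2).
  - apply divisor_cond_no_constant_limit. assumption.
Qed.

(** * Almost periodicity *)

Lemma rho_eq_0 p q : rho p q = 0 -> p = q.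
Proof.
  assert (K : forall z, rho (Some z) None <> 0).
  { intros z. simpl. apply Rgt_not_eq, Rdiv_lt_0_compat; [lra|]. apply sqrt_lt_R0.
    assert (P := pow2_ge_0 (Cnorm z)). simpl in P. lra. }
  intro H. destruct p as [z|], q as [w|].
  - f_equal. apply Cmod_minus_eq_0. apply Rle_antisym; [|apply Cmod_ge_0].
    set (K0 := Rmax (Cmod z) (Cmod w)).
    assert (A : Cmod (z - w) <= (1 + K0 ^ 2) / 2 * rho (Some z) (Some w))
      by (apply dist_le_rho; [apply Rmax_l|apply Rmax_r]).
    rewrite H, Rmult_0_r in A. exact A.
  - exfalso. exact (K z H).
  - exfalso. rewrite rho_sym in H. exact (K w H).
  - reflexivity.
Qed.

Definition almost_period (f : Cx -> Csph) (eps : R) (tau : Cx) : Prop :=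
  forall z : Cx, rho (f (z + tau)%C) (f z) < eps.

Definition uniformly_cauchy (f : Cx -> Csph) (h : nat -> Cx) : Prop :=
  forall eps, 0 < eps -> exists N, forall m n, (N <= m)%nat -> (N <= n)%nat ->
    forall z, rho (f (z + h m)%C) (f (z + h n)%C) < eps.

Lemma AE_almost_period f eps : in_AE f -> 0 < eps ->
  exists L, forall w : Cx, exists tau : Cx, Cmod (tau - w) < L /\ almost_period f eps tau.
Proof. intros (_ & _ & H) He. exact (H eps He). Qed.

(** An almost period close to - x moves a violating pair (x, y) into a bounded region while changing
    each value by less than eps/4; there the moved points accumulate and plain continuity gives a
    contradiction. *)
Lemma AE_unif_cont f : in_AE f -> unif_cont f.
Proof.
  intros HA. apply NNPP. intro NU.
  apply not_all_ex_not in NU. destruct NU as [eps NU].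
  apply imply_to_and in NU. destruct NU as [He NU].
  destruct (AE_almost_period f (eps / 4) HA) as [L HL]; [lra|].
  destruct (seq_choice (fun n (p : Cx * Cx * Cx) =>
     Cmod (snd (fst p) - fst (fst p)) < / (INR n + 1) /\
     eps <= rho (f (snd (fst p))) (f (fst (fst p))) /\
     Cmod (snd p - - fst (fst p)) < L /\ almost_period f (eps / 4) (snd p))) as [u Hu].
  { intro n. apply NNPP. intro N. apply NU. exists (/ (INR n + 1)).
    split; [apply inv_INR_pos|]. intros z w Hzw. apply Rnot_le_lt. intro.
    destruct (HL (- z)%C) as (tau & Ht & Hp).
    apply N. exists (z, w, tau). auto. }
  set (x := fun n => fst (fst (u n))). set (y := fun n => snd (fst (u n))).
  set (tau := fun n => snd (u n)).
  destruct (bolzano_weierstrass_C (fun n => x n + tau n)%C L) as (phi & l & Hphi & Hlim).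
  { intro n. destruct (Hu n) as (_ & _ & H & _). fold (x n) (tau n) in H.
    replace (x n + tau n)%C with (tau n - - x n)%C by ring. lra. }
  destruct (meromorphic_rho_continuous f l (eps / 4) (proj1 HA)) as (d & Hd & Hc); [lra|].
  destruct (Hlim (d / 2)) as [N HN]; [lra|].
  destruct (inv_INR_small (d / 2)) as [N' HN']; [lra|].
  set (n := Nat.max N N'). assert (Hge := increasing_seq_ge _ Hphi n).
  specialize (HN n ltac:(unfold n; lia)). specialize (HN' (phi n) ltac:(unfold n in *; lia)).
  set (j := phi n) in *. destruct (Hu j) as (H1 & H2 & _ & H4).
  fold (x j) (y j) in H1, H2. fold (tau j) in H4.
  assert (A := Hc (x j + tau j)%C ltac:(lra)).
  assert (B : rho (f (y j + tau j)%C) (f l) < eps / 4).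
  { apply Hc. replace (y j + tau j - l)%C with ((y j - x j) + (x j + tau j - l))%C by ring.
    eapply Rle_lt_trans; [apply Cmod_triangle|]. lra. }
  assert (P1 := H4 (x j)). assert (P2 := H4 (y j)).
  assert (T1 := rho_triangle3 (f (y j)) (f (y j + tau j)%C) (f (x j + tau j)%C) (f (x j))).
  assert (T2 := rho_triangle (f (y j + tau j)%C) (f l) (f (x j + tau j)%C)).
  rewrite (rho_sym (f (y j)) (f (y j + tau j)%C)) in T1. rewrite (rho_sym (f l)) in T2. lra.
Qed.

(** Cantor's diagonal argument: from index k on, the diagonal takes its values in the k-th extracted
    subsequence. *)
Lemma diagonal_sequence (A : nat -> nat -> nat -> Prop) :
  (forall k phi, increasing_seq phi -> exists psi, increasing_seq psi /\
     forall m n, A k (phi (psi m)) (phi (psi n))) ->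
  exists phi, increasing_seq phi /\
    forall k, exists N, forall m n, (N <= m)%nat -> (N <= n)%nat -> A k (phi m) (phi n).
Proof.
  intro H.
  (* Moving the premise below the existential makes psi choosable as a total function of k and phi,
     which the recursion needs. *)
  assert (H' : forall k phi, exists psi, increasing_seq phi -> increasing_seq psi /\
     forall m n, A k (phi (psi m)) (phi (psi n))).
  { intros k phi. destruct (classic (increasing_seq phi)) as [Hp|N].
    - destruct (H k phi Hp) as [psi Hpsi]. exists psi. auto.
    - exists (fun n => n). contradiction. }
  set (g := fun k phi => proj1_sig (constructive_indefinite_description _ (H' k phi))).
  assert (Hg : forall k phi, increasing_seq phi -> increasing_seq (g k phi) /\
     forall m n, A k (phi (g k phi m)) (phi (g k phi n))).
  { intros k phi. unfold g. exact (proj2_sig (constructive_indefinite_description _ (H' k phi))). }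
  set (Phi := fix Phi k := match k with
    | O => g 0%nat (fun n => n)
    | S j => fun n => Phi j (g (S j) (Phi j) n) end).
  assert (Hid : increasing_seq (fun n => n)) by (intro n; lia).
  assert (HI : forall k, increasing_seq (Phi k)).
  { induction k as [|k IH]; [apply Hg; assumption|].
    exact (increasing_seq_comp _ _ IH (proj1 (Hg (S k) _ IH))). }
  assert (HA : forall k m n, A k (Phi k m) (Phi k n)).
  { intros [|k] m n.
    - exact (proj2 (Hg 0%nat _ Hid) m n).
    - exact (proj2 (Hg (S k) _ (HI k)) m n). }
  assert (Hsub : forall k i n, exists q, Phi (k + i)%nat n = Phi k q).
  { intros k i. induction i as [|i IH]; intro n.
    - rewrite Nat.add_0_r. exists n. reflexivity.
    - rewrite Nat.add_succ_r. apply (IH (g (S (k + i)) (Phi (k + i)%nat) n)). }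
  exists (fun n => Phi n n). split.
  - intro n. change (Phi n n < Phi n (g (S n) (Phi n) (S n)))%nat.
    apply increasing_seq_lt; [apply HI|].
    assert (X := increasing_seq_ge _ (proj1 (Hg (S n) _ (HI n))) (S n)). lia.
  - intro k. exists k. intros m n Hm Hn.
    destruct (Hsub k (m - k)%nat m) as [p Hp]. destruct (Hsub k (n - k)%nat n) as [q Hq].
    replace (k + (m - k))%nat with m in Hp by lia. replace (k + (n - k))%nat with n in Hq by lia.
    rewrite Hp, Hq. apply HA.
Qed.

(** For fixed accuracy write h n = tau n + remainder, with tau n an almost period and the remainder
    bounded. The remainders converge along a subsequence and uniform continuity absorbs them. A
    diagonal sequence serves all accuracies. *)
Lemma bochner f h : in_AE f ->
  exists phi, increasing_seq phi /\ uniformly_cauchy f (fun n => h (phi n)).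
Proof.
  intro HA.
  destruct (diagonal_sequence (fun k m n =>
    forall z, rho (f (z + h m)%C) (f (z + h n)%C) < / (INR k + 1))) as (phi & Hphi & H).
  - intros k phi Hphi. assert (He := inv_INR_pos k). set (eps := / (INR k + 1)) in *.
    destruct (AE_almost_period f (eps / 4) HA) as [L HL]; [lra|].
    destruct (seq_choice (fun n tau => Cmod (tau - h (phi n)) < L /\
       almost_period f (eps / 4) tau)) as [tau Htau].
    { intro n. apply HL. }
    destruct (bolzano_weierstrass_C (fun n => h (phi n) - tau n)%C L) as (psi & l & Hpsi & Hlim).
    { intro n. rewrite Cmod_minus_sym. apply Rlt_le, Htau. }
    destruct (AE_unif_cont f HA (eps / 4)) as (d & Hd & Huc); [lra|].
    destruct (Hlim (d / 2)) as [N HN]; [lra|].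
    exists (fun n => psi (N + n)%nat). split.
    { intro n. rewrite Nat.add_succ_r. apply Hpsi. }
    intros m n z. set (i := psi (N + m)%nat). set (j := psi (N + n)%nat).
    assert (Hi := HN (N + m)%nat ltac:(lia)). fold i in Hi.
    assert (Hj := HN (N + n)%nat ltac:(lia)). fold j in Hj.
    set (a := (h (phi i) - tau i)%C) in *. set (b := (h (phi j) - tau j)%C) in *.
    assert (Pi := proj2 (Htau i) (z + a)%C). assert (Pj := proj2 (Htau j) (z + b)%C).
    replace (z + a + tau i)%C with (z + h (phi i))%C in Pi by (unfold a; ring).
    replace (z + b + tau j)%C with (z + h (phi j))%C in Pj by (unfold b; ring).
    assert (Q := Huc (z + b)%C (z + a)%C).
    replace (z + a - (z + b))%C with (a - b)%C in Q by ring.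
    assert (T := Cmod_minus_triangle a l b). rewrite (Cmod_minus_sym l b) in T.
    specialize (Q ltac:(lra)).
    assert (T3 := rho_triangle3 (f (z + h (phi i))%C) (f (z + a)%C) (f (z + b)%C)
       (f (z + h (phi j))%C)).
    rewrite (rho_sym (f (z + b)%C)) in T3. lra.
  - exists phi. split; [assumption|]. intros eps He.
    destruct (inv_INR_small eps He) as [k Hk]. destruct (H k) as [N HN].
    exists N. intros m n Hm Hn z. eapply Rlt_trans; [apply HN; assumption|].
    apply Hk. lia.
Qed.

Lemma AE_normal f : in_AE f -> normal f.
Proof.
  intro HA. split; [apply HA|]. intro h. destruct (bochner f h HA) as (phi & Hphi & H).
  exists phi. split; [assumption|]. intros r eps He. destruct (H eps He) as [N HN].
  exists N. intros m n Hm Hn z _. apply HN; assumption.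
Qed.

(** Suppose f is close to c on a large disc around b. For any z, an almost period tau near - b puts
    z - tau into that disc, so f(z) is close to c as well. Hence f would be constant. *)
Lemma AE_in_N1 f : in_AE f -> in_N1 f.
Proof.
  intro HA. split; [apply AE_normal; assumption|]. intros (h & c & Hc).
  destruct (proj1 (proj2 HA)) as (z0 & w0 & Hne). apply Hne.
  assert (Hcl : forall (z : Cx) eps, 0 < eps -> rho (f z) c < eps).
  { intros z eps He.
    destruct (AE_almost_period f (eps / 2) HA) as [L HL]; [lra|].
    destruct (Hc (Cmod z + L) (eps / 2)) as [N HN]; [lra|].
    specialize (HN N (Nat.le_refl N)). set (b := h N : Cx) in *.
    destruct (HL (- b)%C) as (tau & Ht & Hp).
    specialize (Hp (z - tau)%C). replace (z - tau + tau)%C with z in Hp by ring.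
    specialize (HN (z - tau - b)%C).
    change (Cmod (z - tau - b) <= Cmod z + L -> rho (f (z - tau - b + b)%C) c < eps / 2) in HN.
    replace (z - tau - b + b)%C with (z - tau)%C in HN by ring.
    replace (z - tau - b)%C with (z - (tau - - b))%C in HN by ring.
    assert (T := Cmod_minus_le z (tau - - b)). specialize (HN ltac:(lra)).
    assert (T2 := rho_triangle (f z) (f (z - tau)%C) c). lra. }
  apply rho_eq_0. apply cond_eq. intros eps He.
  assert (P := rho_nonneg (f z0) (f w0)).
  rewrite Rminus_0_r, Rabs_right by lra.
  assert (A := Hcl z0 (eps / 2) ltac:(lra)). assert (B := Hcl w0 (eps / 2) ltac:(lra)).
  assert (T := rho_triangle (f z0) c (f w0)). rewrite (rho_sym c) in T. lra.
Qed.

(* h n is the centre of an avoiding disc whose radius exceeds |h m| for all m < n. *)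
Lemma differences_avoid (P : Cx -> Prop) :
  (forall L, exists w, forall tau : Cx, Cmod (tau - w) < L -> ~ P tau) ->
  exists h : nat -> Cx, forall m n, (m < n)%nat -> ~ P (h n - h m)%C.
Proof.
  intro H.
  set (w := fun L => proj1_sig (constructive_indefinite_description _ (H L))).
  assert (Hw : forall L tau, Cmod (tau - w L) < L -> ~ P tau).
  { intro L. exact (proj2_sig (constructive_indefinite_description _ (H L))). }
  (* The state holds h n together with a radius larger than the modulus of every term up to n. *)
  set (S := fix S n := match n with
    | O => (RtoC 0, 1)
    | Datatypes.S j => (w (snd (S j)), snd (S j) + 1 + Cmod (w (snd (S j)))) end).
  assert (Hmono : forall n i, snd (S n) <= snd (S (i + n)%nat)).
  { intros n i. induction i as [|i IH]; [simpl; lra|].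
    change (snd (S n) <= snd (S (i + n)%nat) + 1 + Cmod (w (snd (S (i + n)%nat)))).
    assert (X := Cmod_ge_0 (w (snd (S (i + n)%nat)))). lra. }
  assert (Hb1 : forall n, 0 < snd (S n)).
  { intro n. specialize (Hmono 0%nat n). rewrite Nat.add_0_r in Hmono. simpl in Hmono. lra. }
  assert (Hb : forall n, Cmod (fst (S n)) < snd (S n)).
  { intros [|n].
    - simpl. rewrite Cmod_0. lra.
    - change (Cmod (w (snd (S n))) < snd (S n) + 1 + Cmod (w (snd (S n)))).
      specialize (Hb1 n). lra. }
  exists (fun n => fst (S n)). intros m [|n] Hmn; [lia|].
  change (~ P (w (snd (S n)) - fst (S m))%C). apply (Hw (snd (S n))).
  replace (w (snd (S n)) - fst (S m) - w (snd (S n)))%C with (- fst (S m))%C by ring.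
  rewrite Cmod_opp. eapply Rlt_le_trans; [apply Hb|].
  replace n with ((n - m) + m)%nat by lia. apply Hmono.
Qed.

(** If common almost periods were not relatively dense, some sequence would have no difference of a
    later and an earlier term among them. Bochner's criterion, applied to [f1] and then to [f2],
    produces exactly such a difference. *)
Lemma common_almost_periods f1 f2 eps : in_AE f1 -> in_AE f2 -> 0 < eps ->
  exists L, forall w : Cx, exists tau : Cx, Cmod (tau - w) < L /\
    almost_period f1 eps tau /\ almost_period f2 eps tau.
Proof.
  intros H1 H2 He. apply NNPP. intro NE.
  destruct (differences_avoid (fun tau => almost_period f1 eps tau /\ almost_period f2 eps tau))
    as [h Hh].
  { intro L. apply NNPP. intro N. apply NE. exists L. intro w. apply NNPP. intro N'.
    apply N. exists w. intros tau Ht HP. apply N'. exists tau. auto. }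
  destruct (bochner f1 h H1) as (phi & Hphi & C1).
  destruct (bochner f2 (fun n => h (phi n)) H2) as (psi & Hpsi & C2).
  destruct (C1 eps He) as [N1 HN1]. destruct (C2 eps He) as [N2 HN2].
  set (N := Nat.max N1 N2).
  assert (G1 := increasing_seq_ge _ Hpsi N). assert (G2 := Hpsi N).
  apply (Hh (phi (psi N)) (phi (psi (S N)))).
  { apply increasing_seq_lt; assumption. }
  assert (E : forall z a b : Cx, (z + (a - b) = z - b + a /\ z = z - b + b)%C).
  { intros. split; ring. }
  split; intro z; destruct (E z (h (phi (psi (S N)))) (h (phi (psi N)))) as [-> E2];
    rewrite E2 at 2.
  - apply HN1; unfold N in *; lia.
  - apply (HN2 (S N) N); unfold N in *; lia.
Qed.

Lemma locally_cauchy_perturb f k h :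
  locally_cauchy f k ->
  (forall eps, 0 < eps -> exists N, forall n, (N <= n)%nat ->
     forall z : Cx, rho (f (z + h n)%C) (f (z + k n)%C) < eps) ->
  locally_cauchy f h.
Proof.
  intros HL HP r eps He. destruct (HL r (eps / 3)) as [N1 H1]; [lra|].
  destruct (HP (eps / 3)) as [N2 H2]; [lra|]. exists (Nat.max N1 N2).
  intros m n Hm Hn z Hz.
  specialize (H1 m n ltac:(lia) ltac:(lia) z Hz).
  assert (A := H2 m ltac:(lia) z). assert (B := H2 n ltac:(lia) z).
  assert (T := rho_triangle3 (f (z + h m)%C) (f (z + k m)%C) (f (z + k n)%C) (f (z + h n)%C)).
  rewrite (rho_sym (f (z + k n)%C) (f (z + h n)%C)) in T. lra.
Qed.

(** The points where g changes by eps may run off to infinity, so they are used as translations. The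
    tolerances 1/(j + 1) make the displaced and the original sequence equivalent for [f1] and [f2],
    hence the interleaved one is Cauchy for both and, by the product argument, for g. *)
Lemma product_almost_periods f1 f2 g eps : is_product f1 f2 g -> in_AE f1 -> in_AE f2 ->
  divisor_cond g -> 0 < eps ->
  exists d, 0 < d /\ forall tau, almost_period f1 d tau -> almost_period f2 d tau ->
    almost_period g eps tau.
Proof.
  intros HP A1 A2 [(d & Hd & Hsep) _] He. apply NNPP. intro NE.
  destruct (seq_choice (fun j (p : Cx * Cx) =>
     almost_period f1 (/ (INR j + 1)) (fst p) /\ almost_period f2 (/ (INR j + 1)) (fst p) /\
     eps <= rho (g (snd p + fst p)%C) (g (snd p)))) as [u Hu].
  { intro j. apply NNPP. intro N. apply NE. exists (/ (INR j + 1)).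
    split; [apply inv_INR_pos|]. intros tau T1 T2 z. apply Rnot_le_lt. intro.
    apply N. exists (tau, z). auto. }
  destruct (common_subsequence f1 f2 (AE_normal f1 A1) (AE_normal f2 A2) (fun j => snd (u j)))
    as (phi & Hphi & C1 & C2).
  (* [k] lists each bad point z_j twice; [h] turns the second copy into z_j + tau_j. *)
  set (k := fun m => snd (u (phi (Nat.div2 m)))).
  set (h := fun m => (k m + (if Nat.even m then RtoC 0 else fst (u (phi (Nat.div2 m)))))%C).
  assert (Hdiv : forall N m, (2 * N <= m)%nat -> (N <= Nat.div2 m)%nat).
  { intros N m Hm. assert (X := Nat.div2_odd m). destruct (Nat.odd m); simpl in X; lia. }
  assert (HL : forall f, locally_cauchy f (fun n => snd (u (phi n))) ->
     (forall j, almost_period f (/ (INR j + 1)) (fst (u j))) -> locally_cauchy f h).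
  { intros f HC HAP. apply locally_cauchy_perturb with k.
    - intros r e Hee. destruct (HC r e Hee) as [N HN]. exists (2 * N)%nat.
      intros m n Hm Hn z Hz. apply HN; auto.
    - intros e Hee. destruct (inv_INR_small e Hee) as [N HN]. exists (2 * N)%nat.
      intros n Hn z. unfold h. destruct (Nat.even n).
      + replace (z + (k n + 0))%C with (z + k n)%C by ring. rewrite rho_refl. assumption.
      + replace (z + (k n + fst (u (phi (Nat.div2 n)))))%C
          with (z + k n + fst (u (phi (Nat.div2 n))))%C by ring.
        eapply Rlt_trans; [apply HAP|]. apply HN.
        assert (X := increasing_seq_ge _ Hphi (Nat.div2 n)). specialize (Hdiv N n Hn). lia. }
  assert (Cg : locally_cauchy g h).
  { apply (product_locally_cauchy f1 f2 g h d); try assumption; try (apply AE_in_N1; assumption).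
    - apply HL; [assumption|]. intro j. apply Hu.
    - apply HL; [assumption|]. intro j. apply Hu. }
  destruct (Cg 0 eps He) as [N HN].
  (* Consecutive terms at the origin compare g(z_j + tau_j) with g(z_j), which were chosen at least
     eps apart. *)
  specialize (HN (S (2 * N)) (2 * N)%nat ltac:(lia) ltac:(lia) 0%C ltac:(rewrite Cmod_0; lra)).
  destruct (Hu (phi N)) as (_ & _ & H3).
  unfold h, k in HN. rewrite Nat.even_succ, Nat.odd_even, Nat.even_even in HN.
  rewrite Nat.div2_succ_double, Nat.div2_double in HN.
  replace (0 + (snd (u (phi N)) + fst (u (phi N))))%C
    with (snd (u (phi N)) + fst (u (phi N)))%C in HN by ring.
  replace (0 + (snd (u (phi N)) + 0))%C with (snd (u (phi N))) in HN by ring. lra.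
Qed.

Lemma product_in_AE f1 f2 g : is_product f1 f2 g -> in_AE f1 -> in_AE f2 ->
  divisor_cond g -> in_AE g.
Proof.
  intros HP A1 A2 HD. split; [apply HP|]. split.
  - destruct HD as [_ [R0 H]]. destruct (H C0) as [(a & _ & Ea) (b & _ & Eb)].
    exists a, b. congruence.
  - intros eps He. destruct (product_almost_periods f1 f2 g eps HP A1 A2 HD He) as (d & Hd & H).
    destruct (common_almost_periods f1 f2 d A1 A2 Hd) as [L HL]. exists L. intro w.
    destruct (HL w) as (tau & Ht & T1 & T2). exists tau. split; [exact Ht|].
    exact (H tau T1 T2).
Qed.

Theorem mainTheorem15 (f1 f2 g : Cplx -> Csph) :
  is_product f1 f2 g ->
  (in_N1 f1 -> in_N1 f2 -> (in_N1 g <-> divisor_cond g)) /\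
  (in_AE f1 -> in_AE f2 -> (in_AE g <-> divisor_cond g)).
Proof.
  intro HP. split; intros H1 H2; split.
  - apply N1_divisor_cond.
  - apply product_in_N1 with f1 f2; assumption.
  - intro HA. apply N1_divisor_cond, AE_in_N1, HA.
  - apply product_in_AE with f1 f2; assumption.
Qed.
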